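(* Let $d\ge 3$ and let $G$ be an infinite Ramanujan graph of degree $d$, that is, an infinite connected $d$-regular multigraph with spectral radius $\rho(G)=2\sqrt{d-1}/d$. Let $X=\langle X_n; n\ge 1\rangle$ be simple random walk on $G$ started at any fixed vertex. Then almost surely $$\lim_{n\to\infty}\frac{1}{n}\bigl|\{k\in[1,n] : k \text{ is a nontrivial cycle time of } X\}\bigr| = 0 .$$
   Context: Conventions. Graphs are infinite, connected, locally finite, undirected multigraphs (loops and multiple edges allowed). Each nonloop edge has two orientations; a loop has only one orientation. An oriented edge $e$ goes from its tail $e^-$ to its head $e^+$ (equal if $e$ is a loop), and $-e$ denotes its reversal, with $-e=e$ iff $e$ is a loop. The degree of a vertex $x$ is the number of oriented edges with tail $x$ (a loop counts once). Simple random walk started at $o$ is recorded by the oriented edges $X_1,X_2,\dots$ it traverses: $X_1^-=o$, and each next edge is uniform among the oriented edges whose tail is the current vertex. The spectral radius is $\rho(G)=\limsup_{n\to\infty}p_n(o,o)^{1/n}$, where $p_n(x,y)$ is the $n$-step transition probability of simple random walk; it does not depend on the vertex $o$. A path is a sequence of oriented edges $(e_1,\dots,e_k)$ with $e_i^+=e_{i+1}^-$; it is a cycle if $k\ge1$ and $e_k^+=e_1^-$. A backtrack is an edge immediately followed by its reversal. A cycle is nontrivial if, when backtracks (consecutive pairs $e,-e$) are erased iteratively, some edge remains (e.g. a single loop is nontrivial, but a loop followed by the same loop is trivial). A time $k$ is a nontrivial cycle time of $X$ if there exist $1\le s\le k\le t$ such that $(X_s,X_{s+1},\dots,X_t)$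 is a nontrivial cycle. *)

(* Defs.v *)
From HB Require Import structures.
From mathcomp Require Import all_boot all_order all_algebra finmap.
From mathcomp Require Import all_classical all_reals all_analysis.

Set Implicit Arguments.
Unset Strict Implicit.
Unset Printing Implicit Defensive.

Import Order.TTheory GRing.Theory Num.Theory.
Import numFieldNormedType.Exports.

Local Open Scope classical_set_scope.
Local Open Scope ring_scope.

(* Locally finite undirected multigraphs; [edge] is the type of *oriented*
   edges.  A loop has a single orientation; conversely, [tail_rev] makes every
   edge fixed by [rev] a loop. *)
Record multigraph := Multigraph {
  vertex : choiceType;
  edge : choiceType;
  tail : edge -> vertex;
  head : edge -> vertex;
  rev : edge -> edge;
  revK : involutive rev;
  tail_rev : forall e, tail (rev e) = head e;
  rev_loop : forall e, tail e = head e -> rev e = e;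
  locally_finite : forall x, finite_set [set e | tail e = x]
}.

Section Graph.
Variable G : multigraph.
Implicit Types (x y o : vertex G) (e f : edge G) (s t : seq (edge G)).

Definition out_edges x : {fset edge G} := fset_set [set e | tail e = x].

Definition degree x : nat := #|` out_edges x|%fset.

Definition regular (d : nat) := forall x, degree x = d.

Definition adj : rel (edge G) := fun e f => head e == tail f.

Definition graph_connected := forall x y, x <> y ->
  exists e s, [/\ path adj e s, tail e = x & head (last e s) = y].

Definition is_cycle s := s <> [::] /\ cycle adj s.

(* [erases s t]: t is obtained from s by erasing finitely many backtracks, one
   after the other. *)
Inductive erases : seq (edge G) -> seq (edge G) -> Prop :=
| erases_refl s : erases s s
| erases_backtrack s1 e s2 t :
    erases (s1 ++ s2) t -> erases (s1 ++ [:: e, rev e & s2]) t.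

Definition nontrivial_cycle s := is_cycle s /\ ~ erases s [::].

(* Trajectories are indexed from 1, so the value of X at 0 is irrelevant. *)
Definition nontrivial_cycle_time (X : nat -> edge G) (k : nat) :=
  exists a b : nat, (1 <= a <= k)%N /\ (k <= b)%N /\
    nontrivial_cycle [seq X i | i <- index_iota a b.+1].

Section Walk.
Variable R : realType.

Definition step_prob x e : R :=
  if tail e == x then (degree x)%:R^-1 else 0.

Fixpoint trans_prob (n : nat) x y : R :=
  if n is m.+1 then \sum_(e <- out_edges x) step_prob x e * trans_prob m (head e) y
  else (x == y)%:R.

Definition spectral_radius o : \bar R :=
  limn_esup (fun n : nat => (trans_prob n o o `^ n%:R^-1)%:E).

Local Open Scope ereal_scope.

(* [last o (map head s)] is the position of the walk after it has traversed s.
   The case s = [::] of the second clause gives the law of X 1. *)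
Definition simple_random_walk d (T : measurableType d) (P : probability T R)
    o (X : nat -> T -> edge G) :=
  (forall n (A : set (edge G)), (0 < n)%N -> measurable (X n @^-1` A)) /\
  (forall s e,
    P [set w | [seq X i w | i <- iota 1 (size s).+1] = rcons s e] =
    P [set w | [seq X i w | i <- iota 1 (size s)] = s] *
    (step_prob (last o (map (@head G) s)) e)%:E).

End Walk.
End Graph.

(* Main.v *)
Require Import Defs.
From mathcomp Require Import all_boot all_order all_algebra finmap.
From mathcomp Require Import all_classical all_reals all_analysis.
From mathcomp Require Import ring lra zify.
Import Defs.
Set Implicit Arguments.
Unset Strict Implicit.
Unset Printing Implicit Defensive.
Import Order.TTheory GRing.Theory Num.Theory.
Import numFieldNormedType.Exports.
Local Open Scope classical_set_scope.
Local Open Scope ring_scope.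

(** The walk is compared with simple random walk on the [d]-regular tree through
the distance [D] from the starting vertex [o]. A vertex is irregular if more
edges fail to increase [D] there than would on a tree. A nontrivial cycle must
contain an irregular vertex, because a closed walk through regular vertices
backtracks wherever [D] has a local maximum and can be erased from there
([regular_closed_erases]). Therefore times in cycles of bounded length are rare
as soon as visits to irregular vertices are rare.

Visits to irregular vertices slow down the growth of [D] along the walk. On the
other hand, the Ramanujan property forces [D] to grow as fast as on the tree, so
that such visits cannot have positive density. For this second point write
[q = d - 1]. Walk counts are positive combinations, with the coefficients of
the tree, of nonbacktracking path counts. The bound [s ^+ n], for every
[s > 2 * sqrt q], on the number of closed walks of length [n] implies a bound of
exponential order [q ^ (k / 2)] on the number of nonbacktracking closed paths of
length [k] ([nb_le_of_walk_sum]), and likewise of order [q ^ ((j + k) / 2)] on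
the number of pairs of nonbacktracking paths of lengths [j] and [k] from [o] to a
common end. For [j < k] this is far below the number [q ^ k] of nonbacktracking
paths of length [k], so most of these do not end at distance [j < k]
([sphere_walk_le]). The two effects are balanced in exponential form in
[irregular_rare]: having [n / m] visits to irregular vertices by time [n] has
exponentially small probability, for every [m].

Long cycles are treated separately. As the spectral radius is less than 1, a
given block of [l] consecutive steps is closed with probability at most
[rho ^+ l], with [rho < 1], whatever precedes it. By a Vitali argument
([vitali_packing]) the times covered by long closed blocks are, up to the factor
3, covered by disjoint ones, and a union bound over the arrangements of disjoint
blocks shows that they rarely cover a positive fraction of the time when their
minimal length is large ([long_coverage_rare]).

All these probabilities are computed as finite averages over walks
([walk_mean]); the Borel-Cantelli lemma turns them into almost sure statements
([prefix_eventually]). *)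

(** * The adjacency operator and nonbacktracking sums *)

Section Nonbacktracking.
Variables (R : realType) (G : multigraph).
Implicit Types (x y o : vertex G) (e : edge G) (f g : vertex G -> R) (k m n : nat).

Lemma mem_out_edges x e : (e \in out_edges x) = (tail e == x).
Proof.
rewrite /out_edges in_fset_set; last exact: locally_finite.
by apply/idP/eqP; rewrite inE.
Qed.

Lemma head_rev e : head (rev e) = tail e.
Proof. by rewrite -tail_rev revK. Qed.

Lemma rev_out e : rev e \in out_edges (head e).
Proof. by rewrite mem_out_edges tail_rev. Qed.

Definition nbr_sum f x : R := \sum_(e <- out_edges x) f (head e).

Definition walk_sum m f := iter m nbr_sum f.

(** Sum of [f (head e')] over the nonbacktracking paths of length [k.+1] that
start with the edge [e], where [e'] is the last edge: all continuations of [e]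
are allowed except [rev e]. Subtracting the forbidden term, instead of filtering
the sum, is what makes the three-term recursions below plain ring identities. *)
Fixpoint nb_edge_sum k f e : R :=
  if k is k'.+1 then
    \sum_(e' <- out_edges (head e)) nb_edge_sum k' f e' - nb_edge_sum k' f (rev e)
  else f (head e).

Definition nb_sum k f x : R :=
  if k is k'.+1 then \sum_(e <- out_edges x) nb_edge_sum k' f e else f x.

#[global] Arguments nb_sum : simpl never.

Lemma nb_sumS k f x : nb_sum k.+1 f x = \sum_(e <- out_edges x) nb_edge_sum k f e.
Proof. by []. Qed.

Lemma nb_edge_sumS k f e : nb_edge_sum k.+1 f e = nb_sum k.+1 f (head e) - nb_edge_sum k f (rev e).
Proof. by []. Qed.

Lemma nb1 f : nb_sum 1 f = nbr_sum f. Proof. by []. Qed.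

Lemma sum_out_const x (c : R) : \sum_(e <- out_edges x) c = (degree x)%:R * c.
Proof.
by rewrite big_const_seq count_predT iter_addr_0 mulr_natl.
Qed.

Lemma eq_out x (F F' : edge G -> R) :
  (forall e, tail e = x -> F e = F' e) ->
  \sum_(e <- out_edges x) F e = \sum_(e <- out_edges x) F' e.
Proof.
move=> FF'; rewrite big_seq [RHS]big_seq; apply: eq_bigr => e.
by rewrite mem_out_edges => /eqP /FF'.
Qed.

Lemma ler_out x (F F' : edge G -> R) :
  (forall e, tail e = x -> F e <= F' e) ->
  \sum_(e <- out_edges x) F e <= \sum_(e <- out_edges x) F' e.
Proof.
move=> FF'; rewrite big_seq [leRHS]big_seq; apply: ler_sum => e.
by rewrite mem_out_edges => /eqP /FF'.
Qed.

(** First instance of the Chebyshev-like recursion: a step followed by a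
nonbacktracking path either is nonbacktracking or undoes the first step, and
from [x] the latter happens once per edge at [x]. *)
Lemma nbr_sum_nb1 f x : nbr_sum (nb_sum 1 f) x = nb_sum 2 f x + (degree x)%:R * f x.
Proof.
rewrite nb_sumS -sum_out_const -big_split /=; apply: eq_out => e <-.
by rewrite head_rev subrK.
Qed.

(** A step followed by a nonbacktracking path of length at least 2 backtracks
exactly when it starts with [e, rev e]; what follows is a shorter nonbacktracking
path that does not start with [e], which leaves [degree x - 1] choices of [e]
for each shorter path. *)
Lemma nbr_sum_nb k f x :
  nbr_sum (nb_sum k.+2 f) x = nb_sum k.+3 f x + ((degree x)%:R - 1) * nb_sum k.+1 f x.
Proof.
have -> : nb_sum k.+3 f x = \sum_(e <- out_edges x)
    (nb_sum k.+2 f (head e) - nb_sum k.+1 f x + nb_edge_sum k f e).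
  rewrite [LHS]/nb_sum; apply: eq_out => e xe.
  by rewrite nb_edge_sumS nb_edge_sumS head_rev revK xe; ring.
have Ea : \sum_(e <- out_edges x) nb_sum k.+2 f (head e) = nbr_sum (nb_sum k.+2 f) x by [].
have Ec : \sum_(e <- out_edges x) nb_edge_sum k f e = nb_sum k.+1 f x by [].
by rewrite big_split /= sumrB sum_out_const Ea Ec; ring.
Qed.

Lemma nbr_sum_ge0 f : (forall x, 0 <= f x) -> forall x, 0 <= nbr_sum f x.
Proof. by move=> f0 x; apply: sumr_ge0. Qed.

Lemma walk_sum_ge0 m f : (forall x, 0 <= f x) -> forall x, 0 <= walk_sum m f x.
Proof. by elim: m => [|m IH]//= f0; apply: nbr_sum_ge0; apply: IH. Qed.

Lemma nb_edge_sum_ge0 k f : (forall x, 0 <= f x) -> forall e, 0 <= nb_edge_sum k f e.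
Proof.
move=> f0; elim: k => [|k IH] e //=.
rewrite (big_fsetD1 (rev e)) ?rev_out//= [X in X - _]addrC addrK.
exact: sumr_ge0.
Qed.

Lemma nb_sum_ge0 k f : (forall x, 0 <= f x) -> forall x, 0 <= nb_sum k f x.
Proof. by case: k => [|k] f0 x //; apply: sumr_ge0 => e _; apply: nb_edge_sum_ge0. Qed.

Lemma nbr_sumD (a b : R) f g : nbr_sum (fun x => a * f x + b * g x) =
  fun x => a * nbr_sum f x + b * nbr_sum g x.
Proof. by apply/funext => x; rewrite /nbr_sum !mulr_sumr -big_split. Qed.

Lemma walk_sumD m (a b : R) f g : walk_sum m (fun x => a * f x + b * g x) =
  fun x => a * walk_sum m f x + b * walk_sum m g x.
Proof. by elim: m => //= m ->; rewrite nbr_sumD. Qed.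

Lemma nb_edge_sumD k (a : R) f g e : nb_edge_sum k (fun x => f x + a * g x) e =
  nb_edge_sum k f e + a * nb_edge_sum k g e.
Proof.
elim: k e => //= k IH e; rewrite IH.
under eq_bigr do rewrite IH.
rewrite big_split -mulr_sumr /=; ring.
Qed.

Lemma nb_sumD k (a : R) f g x : nb_sum k (fun x => f x + a * g x) x =
  nb_sum k f x + a * nb_sum k g x.
Proof.
case: k => // k; rewrite !nb_sumS; under eq_bigr do rewrite nb_edge_sumD.
by rewrite big_split -mulr_sumr.
Qed.

Lemma le_nbr_sum f g : (forall x, f x <= g x) -> forall x, nbr_sum f x <= nbr_sum g x.
Proof. by move=> fg x; apply: ler_sum. Qed.

Lemma le_walk_sum m f g : (forall x, f x <= g x) ->
  forall x, walk_sum m f x <= walk_sum m g x.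
Proof. by elim: m => //= m IH fg; apply: le_nbr_sum; apply: IH. Qed.

Lemma le_nb k f g : (forall x, f x <= g x) -> forall x, nb_sum k f x <= nb_sum k g x.
Proof.
move=> fg x; rewrite -subr_ge0.
have -> : nb_sum k g x - nb_sum k f x = nb_sum k (fun x => g x + (-1) * f x) x.
  by rewrite nb_sumD mulN1r.
by apply: nb_sum_ge0 => y; rewrite mulN1r subr_ge0.
Qed.

Lemma walk_sumSr m f : walk_sum m.+1 f = walk_sum m (nbr_sum f).
Proof. by rewrite /walk_sum iterSr. Qed.

Lemma walk_sum_add m n f : walk_sum (m + n) f = walk_sum m (walk_sum n f).
Proof. by rewrite /walk_sum iterD. Qed.

Section Regular.
Variable d : nat.
Hypothesis Gd : regular G d.
Hypothesis d3 : (3 <= d)%N.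
Let q : R := d%:R - 1.

Let q2 : 2 <= q.
Proof. have h : (3%:R : R) <= d%:R by rewrite ler_nat.
by rewrite /q; lra. Qed.

Lemma nb2E f : nb_sum 2 f = fun x => nbr_sum (nb_sum 1 f) x - d%:R * f x.
Proof. by apply/funext => x; rewrite nbr_sum_nb1 Gd addrK. Qed.

Lemma nb3E k f : nb_sum k.+3 f = fun x => nbr_sum (nb_sum k.+2 f) x - q * nb_sum k.+1 f x.
Proof. by apply/funext => x; rewrite nbr_sum_nb Gd addrK. Qed.

(** By the recursion, the nonbacktracking operators are polynomials in the
adjacency operator, so they commute with it. *)
Lemma nb_nbr_sum k f : nb_sum k (nbr_sum f) = nbr_sum (nb_sum k f).
Proof.
suff: nb_sum k (nbr_sum f) = nbr_sum (nb_sum k f) /\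
      nb_sum k.+1 (nbr_sum f) = nbr_sum (nb_sum k.+1 f) by case.
elim: k => [//|k [IH1 IH2]]; split => //.
have subE (a : R) g h : (fun x => g x - a * h x) = (fun x => 1 * g x + (- a) * h x).
  by apply/funext => x; rewrite mulNr mul1r.
case: k IH1 IH2 => [|k] IH1 IH2.
  by rewrite !nb2E IH2 !subE nbr_sumD.
by rewrite !nb3E IH1 IH2 !subE nbr_sumD.
Qed.

Lemma nb_walk_sum k m f : nb_sum k (walk_sum m f) = walk_sum m (nb_sum k f).
Proof. by elim: m => //= m IH; rewrite nb_nbr_sum IH. Qed.

Lemma nb_le_walk_sum k f : (forall x, 0 <= f x) ->
  forall x, nb_sum k f x <= walk_sum k f x.
Proof.
move=> f0; elim: k => // k IH x.
apply: (@le_trans _ _ (nbr_sum (nb_sum k f) x)); last by apply: le_nbr_sum.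
case: k {IH} => [//|[|k]].
  by rewrite nb2E gerBl mulr_ge0.
rewrite nb3E gerBl mulr_ge0 ?nb_sum_ge0//.
by rewrite (le_trans _ q2).
Qed.

Lemma nb_cst1 k x : nb_sum k.+1 (fun=> 1) x = d%:R * q ^+ k.
Proof.
have nbeE j e : nb_edge_sum j (fun=> 1) e = q ^+ j.
  elim: j e => //= j IH e; rewrite IH.
  under eq_bigr do rewrite IH.
  by rewrite sum_out_const Gd exprS /q; ring.
by rewrite nb_sumS; under eq_bigr do rewrite nbeE; rewrite sum_out_const Gd.
Qed.

(** Trivial bound by the number of nonbacktracking paths, [d * q ^+ k.-1],
weakened to [2 * q ^+ k] so that it also covers [k = 0]. *)
Lemma nb_le_pow k f : (forall x, f x <= 1) -> forall x, nb_sum k f x <= 2 * q ^+ k.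
Proof.
move=> f1 x; apply: le_trans (le_nb k f1 x) _.
case: k => [|k]; first by rewrite (_ : nb_sum 0 _ x = 1)// expr0; lra.
rewrite nb_cst1 exprS mulrA ler_wpM2r ?exprn_ge0//; first by move: q2; lra.
by move: q2; rewrite /q; lra.
Qed.

End Regular.
End Nonbacktracking.

(** * From return bounds to nonbacktracking bounds *)

Lemma expr_lt_eventually (R : realType) (t e : R) :
  0 <= t < 1 -> 0 < e -> exists M : nat, t ^+ M < e.
Proof.
move=> /andP[t0 t1] e0.
have /cvgrPdist_lt /(_ e e0) [M _ /(_ M (leqnn M))] :
    (GRing.exp t : R^nat) @ \oo --> 0 by apply: cvg_expr; rewrite ger0_norm.
by rewrite /= sub0r normrN ger0_norm ?exprn_ge0// => ?; exists M.
Qed.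

(** Used to discard the remainder of a finite iteration instead of summing a
convergent series. *)
Lemma ler_geometric_error (R : realType) (a b c t : R) :
  0 <= t < 1 -> (forall M : nat, a <= b + c * t ^+ M) -> a <= b.
Proof.
move=> t01 abc; rewrite leNgt; apply/negP => ba.
have c0 : 0 < c by have := abc 0%N; rewrite expr0; lra.
have ab : 0 < a - b by lra.
have [M] := expr_lt_eventually t01 (divr_gt0 ab c0).
by have := abc M; rewrite ltr_pdivlMr// mulrC; lra.
Qed.

Lemma geometric_sum_le (R : realFieldType) (t : R) n :
  0 <= t < 1 -> \sum_(i < n) t ^+ i <= (1 - t)^-1.
Proof.
move=> /andP[t0 t1]; have t1' : 0 < 1 - t by lra.
rewrite -[leRHS]mul1r ler_pdivlMr// mulrC -opprB mulNr -subrX1 opprB.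
by rewrite gerBl exprn_ge0.
Qed.

(** If the sums of [f] over the walks from [o] grow at most like [s ^+ m] with
[s] below [p * (x + x^-1)], where [p] is the square root of [d - 1] and [x > 1],
then the nonbacktracking sums from [o] grow at most like [(p * x) ^+ k]. The
combination [H] of the first nonbacktracking sums, with coefficients [phi], is
chosen so that
[H <= phi 0 * f + z * A H] for the adjacency operator [A]: the coefficients
solve the recursion dual to that of the nonbacktracking sums and vanish at
[k.+1], where the sum can therefore be cut off. Iterating this inequality bounds
[H] by the generating function of the walk sums at [z], which converges since
[z * s < 1], and every term of [H] is nonnegative. *)
Section Green.
Variables (R : realType) (G : multigraph) (d : nat).
Hypotheses (Gd : regular G d) (d3 : (3 <= d)%N).
Variables (p x s K : R) (f : vertex G -> R) (o : vertex G).
Hypotheses (p_gt0 : 0 < p) (p2 : p ^+ 2 = d%:R - 1) (x_gt1 : 1 < x).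
Hypotheses (s_ge0 : 0 <= s) (s_lt : s < p * (x + x^-1)).
Hypothesis f_ge0 : forall y, 0 <= f y.
Hypothesis walk_le : forall m, walk_sum m f o <= K * s ^+ m.

Let psi n : R := x ^+ n - x ^- n.
Let z := (p * (x + x^-1))^-1.

Let x_gt0 : 0 < x. Proof. exact: lt_trans x_gt1. Qed.

Let xn_gt0 n : 0 < x ^+ n. Proof. exact: exprn_gt0. Qed.

Let psi_ge0 n : 0 <= psi n.
Proof.
rewrite subr_ge0 (@le_trans _ _ 1)//; last by rewrite exprn_ege1// ltW.
by rewrite invf_le1// exprn_ege1// ltW.
Qed.

Let psi_rec n : psi n.+2 + psi n = (x + x^-1) * psi n.+1.
Proof. by rewrite /psi !exprS; field; rewrite !gt_eqF. Qed.

Let q_ge2 : (2 : R) <= p ^+ 2.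
Proof. rewrite p2; have : (3%:R : R) <= d%:R by rewrite ler_nat. lra. Qed.

Let z_gt0 : 0 < z.
Proof. by rewrite invr_gt0 mulr_gt0// addr_gt0// invr_gt0. Qed.

Variable k : nat.
Let phi i : R := psi (k.+1 - i) / p ^+ i.
Let H y : R := \sum_(i < k.+1) phi i * nb_sum i f y.

Let phi_ge0 i : 0 <= phi i.
Proof. by rewrite divr_ge0 ?psi_ge0// exprn_ge0// ltW. Qed.

Let phi_rec i : (i < k)%N -> z * (phi i + p ^+ 2 * phi i.+2) = phi i.+1.
Proof.
move=> ik; rewrite /phi.
have -> : (k.+1 - i = (k - i.+1).+2)%N by lia.
have -> : (k.+1 - i.+1 = (k - i.+1).+1)%N by lia.
have -> : (k.+1 - i.+2 = k - i.+1)%N by lia.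
set n := (k - i.+1)%N.
have -> : psi n.+2 / p ^+ i + p ^+ 2 * (psi n / p ^+ i.+2) =
          (psi n.+2 + psi n) / p ^+ i.
  by rewrite !exprS; field; rewrite expf_neq0 gt_eqF.
rewrite psi_rec /z exprS; field.
by rewrite !gt_eqF ?exprn_gt0//= addr_gt0// mulr_gt0.
Qed.

Let H_subsolution y : H y <= phi 0 * f y + z * nbr_sum H y.
Proof.
have -> : nbr_sum H y = \sum_(i < k.+1) phi i * nbr_sum (nb_sum i f) y.
  rewrite /nbr_sum /H exchange_big /=; apply: eq_bigr => i _.
  by rewrite mulr_sumr.
rewrite /H big_ord_recl /= lerD2l.
pose N i := nb_sum i f y.
have N0 i : 0 <= N i by apply: nb_sum_ge0.
have step i : N i.+2 + p ^+ 2 * N i <= nbr_sum (nb_sum i.+1 f) y.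
  rewrite /N; case: i => [|i].
    by rewrite nbr_sum_nb1 Gd p2 lerD2l ler_wpM2r ?f_ge0// gerBl.
  by rewrite nbr_sum_nb Gd p2 lerD2l.
apply: (@le_trans _ _ (z * (\sum_(i < k.+1) phi i * N i.+1 +
    \sum_(i < k) phi i.+1 * (p ^+ 2 * N i)))); last first.
  rewrite ler_pM2l// big_ord_recl [leRHS]big_ord_recl /= -addrA lerD2l.
  rewrite -big_split /= ler_sum// => i _; rewrite /bump /= add1n -mulrDr.
  by rewrite ler_wpM2l ?phi_ge0 ?step.
have -> : \sum_(i < k) phi i.+1 * (p ^+ 2 * N i) =
    phi 1 * (p ^+ 2 * N 0) + \sum_(i < k) phi i.+2 * (p ^+ 2 * N i.+1).
  transitivity (\sum_(i < k.+1) phi i.+1 * (p ^+ 2 * N i)).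
    rewrite big_ord_recr /= [phi k.+1]/phi subnn /psi expr0 invr1 subrr.
    by rewrite !mul0r addr0.
  by rewrite big_ord_recl.
rewrite big_ord_recr /=.
rewrite (_ : \sum_(i < k) _ =
   z * (\sum_(i < k) phi i * N i.+1 + \sum_(i < k) phi i.+2 * (p ^+ 2 * N i.+1))).
  rewrite ler_pM2l//.
  rewrite -[leRHS]addrA lerD2l addrA lerDr addr_ge0//; apply: mulr_ge0 => //.
  by apply: mulr_ge0 => //; apply: sqr_ge0.
rewrite -big_split mulr_sumr; apply: eq_bigr => i _ /=.
rewrite -(phi_rec (ltn_ord i)) /N /bump /= add1n; ring.
Qed.

(* The remainder [z ^+ M * walk_sum M H y] is killed later by [z * s < 1]. *)
Let H_iter M y :
  H y <= phi 0 * (\sum_(m < M) z ^+ m * walk_sum m f y) + z ^+ M * walk_sum M H y.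
Proof.
elim: M => [|M IH]; first by rewrite big_ord0 mulr0 add0r expr0 mul1r.
apply: le_trans IH _.
rewrite big_ord_recr /= mulrDr -addrA lerD2l.
rewrite exprSr.
have /(_ M y) := le_walk_sum _ H_subsolution; rewrite walk_sumD -walk_sumSr => Hle.
apply: le_trans (ler_wpM2l (exprn_ge0 M (ltW z_gt0)) Hle) _.
by rewrite le_eqVlt; apply/orP; left; apply/eqP => /=; ring.
Qed.

Let walk_H_le M : walk_sum M H o <= \sum_(i < k.+1) phi i * (K * s ^+ (M + i)).
Proof.
have walk_sum_bigsum n : walk_sum M (fun y => \sum_(i < n) phi i * nb_sum i f y) o =
    \sum_(i < n) phi i * walk_sum M (nb_sum i f) o.
  elim: n => [|n IH].
    under eq_fun do rewrite big_ord0; rewrite big_ord0.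
    by elim: M o => //= M' IH' o'; apply: big1_seq => e _; rewrite IH'.
  have -> : (fun y => \sum_(i < n.+1) phi i * nb_sum i f y) =
      (fun y => 1 * (\sum_(i < n) phi i * nb_sum i f y) + phi n * nb_sum n f y).
    by apply/funext => y; rewrite big_ord_recr mul1r.
  by rewrite walk_sumD big_ord_recr /= -IH mul1r.
rewrite /H walk_sum_bigsum; apply: ler_sum => i _; rewrite ler_wpM2l ?phi_ge0//.
apply: le_trans (walk_le _); rewrite walk_sum_add.
by apply: le_walk_sum => y; apply: nb_le_walk_sum.
Qed.

(** What remains is to compare [phi 0], of order [x ^+ k.+1], with [phi k],
which is [(x - x^-1) / p ^+ k]. *)
Lemma nb_le_of_walk_sum :
  nb_sum k f o <= K * (x / (x - x^-1) / (1 - z * s)) * (p * x) ^+ k.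
Proof.
have zs01 : 0 <= z * s < 1.
  rewrite mulr_ge0 ?(ltW z_gt0)//= /z mulrC ltr_pdivrMr ?mul1r//.
  by rewrite -invr_gt0.
have K0 : 0 <= K by have := walk_le 0; rewrite expr0 mulr1; apply: le_trans.
have Hle : H o <= phi 0 * (K / (1 - z * s)).
  apply: (@ler_geometric_error _ _ _ (\sum_(i < k.+1) phi i * (K * s ^+ i)) (z * s)) => // M.
  apply: le_trans (H_iter M o) _; apply: lerD.
    rewrite ler_wpM2l ?phi_ge0//.
    apply: (@le_trans _ _ (\sum_(m < M) K * (z * s) ^+ m)).
      apply: ler_sum => i _; rewrite exprMn mulrCA ler_wpM2l//.
      by rewrite exprn_ge0// ltW.
    by rewrite -mulr_sumr ler_wpM2l// geometric_sum_le.
  apply: le_trans (ler_wpM2l (exprn_ge0 M (ltW z_gt0)) (walk_H_le M)) _.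
  rewrite exprMn le_eqVlt; apply/orP; left; apply/eqP.
  rewrite mulr_sumr mulr_suml; apply: eq_bigr => i _; rewrite exprD; ring.
have phik : phi k * nb_sum k f o <= H o.
  rewrite /H big_ord_recr /= lerDr sumr_ge0// => i _.
  by rewrite mulr_ge0 ?phi_ge0 ?nb_sum_ge0.
have x1 : 0 < x - x^-1 by rewrite subr_gt0 (@lt_trans _ _ 1)// invf_lt1.
have phikE : phi k = (x - x^-1) / p ^+ k.
  by rewrite /phi (_ : k.+1 - k = 1)%N ?subSnn// /psi !expr1.
have phi0_le : phi 0 <= x ^+ k.+1.
  by rewrite /phi subn0 expr0 divr1 /psi gerBl invr_ge0 ltW.
have : nb_sum k f o <= p ^+ k / (x - x^-1) * (x ^+ k.+1 * (K / (1 - z * s))).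
  have pk : 0 < (x - x^-1) / p ^+ k by rewrite divr_gt0 ?exprn_gt0.
  rewrite -(ler_pM2l pk) -{1}phikE.
  apply: le_trans phik (le_trans Hle _).
  have -> : (x - x^-1) / p ^+ k * (p ^+ k / (x - x^-1) * (x ^+ k.+1 * (K / (1 - z * s))))
     = x ^+ k.+1 * (K / (1 - z * s)).
    set w := x ^+ k.+1 * _; set u := x - x^-1.
    by field; rewrite !gt_eqF ?exprn_gt0.
  by rewrite ler_wpM2r// divr_ge0// subr_ge0; case/andP: zs01 => _ /ltW.
move=> /le_trans; apply; rewrite le_eqVlt; apply/orP; left; apply/eqP.
by rewrite exprS exprMn; ring.
Qed.
End Green.

(** * Distance from the starting vertex *)

Section Distance.
Variables (R : realType) (G : multigraph) (d : nat).
Hypotheses (Gd : regular G d) (d3 : (3 <= d)%N) (Gconn : graph_connected G).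
Variable o : vertex G.
Implicit Types (x : vertex G) (e : edge G) (i j k m n : nat).
Let q : R := d%:R - 1.

Let q_ge2 : 2 <= q.
Proof. have h : (3%:R : R) <= d%:R by rewrite ler_nat.
by rewrite /q; lra. Qed.

Definition dirac_fun x : R := (x == o)%:R.

Let delta_ge0 x : 0 <= dirac_fun x. Proof. exact: ler0n. Qed.

Let nbd_ge0 j x : 0 <= nb_sum j dirac_fun x.
Proof. exact: nb_sum_ge0. Qed.

Lemma nb_dirac_neighbor j e : nb_sum j dirac_fun (tail e) != 0 ->
  exists2 i, (i <= j.+1)%N & nb_sum i dirac_fun (head e) != 0.
Proof.
move=> nz; have : 0 < nbr_sum (nb_sum j dirac_fun) (head e).
  rewrite /nbr_sum (big_fsetD1 (rev e)) ?rev_out//= head_rev.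
  by rewrite ltr_pwDl ?lt_neqAle ?nbd_ge0 ?andbT 1?eq_sym// sumr_ge0.
case: j nz => [|[|j]] nz.
- by rewrite -nb1 => /gt_eqF/negbT ?; exists 1.
- rewrite nbr_sum_nb1; have [->|? _] := eqVneq (nb_sum 2 dirac_fun (head e)) 0; last by exists 2.
  rewrite add0r Gd => /gt_eqF/negbT; rewrite mulf_eq0 negb_or => /andP[_ ?].
  by exists 0.
- rewrite nbr_sum_nb; have [->|? _] := eqVneq (nb_sum j.+3 dirac_fun (head e)) 0; last by exists j.+3.
  rewrite add0r Gd => /gt_eqF/negbT; rewrite mulf_eq0 negb_or => /andP[_ ?].
  by exists j.+1; rewrite // -addn2 leq_addr.
Qed.

Lemma nb_dirac_pred j x : nb_sum j.+1 dirac_fun x != 0 ->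
  exists2 e, tail e = x & nb_sum j dirac_fun (head e) != 0.
Proof.
move=> nz; have [e /andP[xe]] : exists e, (e \in out_edges x) && (nb_edge_sum j dirac_fun e != 0).
  apply/not_existsP => nex; move: nz; rewrite nb_sumS big1_seq ?eqxx// => e /andP[_ xe].
  by apply/eqP; have := nex e; rewrite xe /= => /negP; rewrite negbK.
move: xe; rewrite mem_out_edges => /eqP xe nze; exists e => //.
case: j nze {nz} => [//|j]; rewrite nb_edge_sumS => nze.
have : 0 < nb_edge_sum j.+1 dirac_fun e by rewrite lt_neqAle eq_sym nb_edge_sumS nze -nb_edge_sumS nb_edge_sum_ge0.
rewrite nb_edge_sumS subr_gt0 => /(le_lt_trans (nb_edge_sum_ge0 _ _ _)) h.
by rewrite gt_eqF// h.
Qed.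

(** Integrality turns a nonzero nonbacktracking count into one that is at least
1. *)
Lemma nb_dirac_int j x : nb_sum j dirac_fun x \is a Num.int.
Proof.
have nb_edge_int i e : nb_edge_sum i dirac_fun e \is a Num.int.
  elim: i e => [|i IH] e; first exact: natr_int.
  by rewrite /= rpredB// rpred_sum.
by case: j => [|j]; [exact: natr_int|rewrite nb_sumS rpred_sum].
Qed.

Lemma nb_dirac_reach x : exists j, nb_sum j dirac_fun x != 0.
Proof.
have [->|ox] := eqVneq x o; first by exists 0; rewrite /nb_sum /dirac_fun eqxx oner_eq0.
have [e [s [+ + <-]]] := Gconn (nesym (elimN eqP ox)).
elim/last_ind: s => [|s e' IH] /=.
  move=> _ oe; have [|i _ ?] := @nb_dirac_neighbor 0 e; last by exists i.
  by rewrite /nb_sum /dirac_fun oe eqxx oner_eq0.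
rewrite rcons_path last_rcons => /andP[pes /eqP adje] oe.
have [j hj] := IH pes oe.
have [|i _ ?] := @nb_dirac_neighbor j e'; last by exists i.
by rewrite -adje.
Qed.

(** This is the graph distance to [o], since geodesics do not backtrack; this
form gives at once the comparison of spheres with nonbacktracking counts. *)
Definition dist x := ex_minn (nb_dirac_reach x).

Lemma dist0 : dist o = 0%N.
Proof.
rewrite /dist; case: ex_minnP => m _ /(_ 0%N).
by rewrite /nb_sum /dirac_fun eqxx oner_eq0 leqn0 => /(_ isT)/eqP.
Qed.

Lemma dist_head e : (dist (head e) <= (dist (tail e)).+1)%N.
Proof.
rewrite {2}/dist; case: ex_minnP => m nz _.
have [i im hi] := nb_dirac_neighbor nz.
by apply: leq_trans im; rewrite /dist; case: ex_minnP => m' _; apply.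
Qed.

Lemma dist_parent x : (0 < dist x)%N -> exists2 e, tail e = x & (dist (head e) < dist x)%N.
Proof.
rewrite {1 3}/dist; case: ex_minnP => -[//|m] nz _ _.
have [e xe he] := nb_dirac_pred nz; exists e => //.
by rewrite ltnS /dist; case: ex_minnP => m' _; apply.
Qed.

(** On a tree this is an equality. On a general graph only the inequality
survives, and it lets spheres be bounded by nonbacktracking operators without
counting their vertices. *)
Lemma sphere_le_nb j x : (dist x == j)%:R <= nb_sum j dirac_fun x.
Proof.
case: eqP => // <-; rewrite /dist; case: ex_minnP => m nz _.
by rewrite -(ger0_norm (nbd_ge0 _ _)) norm_intr_ge1 ?nb_dirac_int.
Qed.

Section Sphere.
Variables (p s : R).
Hypotheses (p_gt0 : 0 < p) (p2 : p ^+ 2 = d%:R - 1) (s_ge0 : 0 <= s).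
Hypothesis walk_le : forall m, walk_sum m dirac_fun o <= s ^+ m.

(** The nonbacktracking bound applied twice: first to a walk count, for the
operator of length [j], then to the function so obtained, for length [k].
Commutation allows the first bound to be read as a bound for walks followed by
nonbacktracking paths. *)
Lemma nb_nb_le y : 1 < y -> s < p * (y + y^-1) -> exists2 C : R, 0 <= C &
  forall j k, nb_sum k (nb_sum j dirac_fun) o <= C * (p * y) ^+ (j + k).
Proof.
move=> y1 sy.
set C := y / (y - y^-1) / (1 - (p * (y + y^-1))^-1 * s).
exists (C * C) => [|j k]; first by rewrite -expr2 sqr_ge0.
have walk_nb_le m i : walk_sum m (nb_sum i dirac_fun) o <= C * (p * y) ^+ i * s ^+ m.
  rewrite -(nb_walk_sum Gd) mulrC mulrA.
  apply: (nb_le_of_walk_sum Gd d3 p_gt0 p2 y1 s_ge0 sy) => [z|n].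
    exact: walk_sum_ge0.
  by rewrite -walk_sum_add -exprD addnC; exact: walk_le.
have -> : C * C * (p * y) ^+ (j + k) = C * (p * y) ^+ j * C * (p * y) ^+ k.
  by rewrite exprD; ring.
by apply: (nb_le_of_walk_sum Gd d3 p_gt0 p2 y1 s_ge0 sy).
Qed.

(** Walk counts expand into nonbacktracking sums with nonnegative coefficients,
namely those of the tree. Hence a geometric bound on the latter, carried along
the recursion as a superharmonic function, yields a bound on the former. *)
Lemma walk_sum_le_of_nb (F : vertex G -> R) (t K : R) n : 0 < t <= 1 -> 0 <= K ->
  (forall k, nb_sum k F o <= K * (q * t) ^+ k) ->
  walk_sum n F o <= K * (q * t + t^-1) ^+ n.
Proof.
move=> /andP[t0 t1] K0 FK; set l := q * t + t^-1.
have q0 : 0 < q by move: q_ge2; lra.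
have qt0 : 0 <= q * t by rewrite ltW// mulr_gt0.
have dE : d%:R = q + 1 by rewrite /q subrK.
have tV : t <= t^-1 by rewrite (le_trans t1)// invf_ge1.
(* The value at 0 compensates for the coefficient [d], instead of [q], that
   the recursion has next to the root. *)
pose g k : R := if k is 0 then 1 else d%:R / q * (q * t) ^+ k.
suff main m k : walk_sum m (nb_sum k F) o <= K * l ^+ m * g k.
  by have := main n 0%N; rewrite mulr1.
elim: m k => [|m IH] k.
  rewrite expr0 mulr1; apply: le_trans (FK k) _; rewrite ler_wpM2l//.
  case: k => [|k]; first by rewrite expr0.
  rewrite /g -[leLHS]mul1r ler_wpM2r ?exprn_ge0// ler_pdivlMr// mul1r dE; lra.
have l0 : 0 <= l ^+ m.
  by rewrite exprn_ge0// addr_ge0// invr_ge0 ltW.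
rewrite walk_sumSr; case: k => [|[|k]].
- apply: le_trans (IH 1%N) _; rewrite exprSr -!mulrA ler_wpM2l// ler_wpM2l//.
  have -> : g 1%N = (q + 1) * t by rewrite /g dE expr1; field; rewrite gt_eqF.
  by rewrite mulr1 /l; lra.
- have -> : nbr_sum (nb_sum 1 F) = fun x => 1 * nb_sum 2 F x + d%:R * nb_sum 0 F x.
    by apply/funext => x; rewrite nbr_sum_nb1 Gd mul1r.
  rewrite walk_sumD mul1r.
  apply: le_trans (lerD (IH 2%N) (ler_wpM2l (ler0n _ d) (IH 0%N))) _.
  rewrite le_eqVlt; apply/orP; left; apply/eqP.
  rewrite [g 0%N]/g /g expr1 [l ^+ m.+1]exprSr; move: (l ^+ m) => lm; rewrite /l.
  by field; rewrite !gt_eqF.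
- have -> : nbr_sum (nb_sum k.+2 F) = fun x => 1 * nb_sum k.+3 F x + q * nb_sum k.+1 F x.
    by apply/funext => x; rewrite nbr_sum_nb Gd mul1r.
  rewrite walk_sumD mul1r.
  apply: le_trans (lerD (IH k.+3) (ler_wpM2l (ltW q0) (IH k.+1))) _.
  rewrite le_eqVlt; apply/orP; left; apply/eqP.
  rewrite /g [l ^+ m.+1]exprSr; move: (l ^+ m) => lm; rewrite /l !exprS.
  by field; rewrite !gt_eqF.
Qed.

(** Divided by [d ^ n], this is the Chernoff bound with parameter [u] that holds
on the tree for being at distance [j] at time [n], up to powers of factors [y]
close to 1. A nonbacktracking path of length
[k] ends at distance [j] in at most [q ^+ k] ways, up to a constant, which is
used for [k <= j], and in at most about [p ^+ (j + k)] ways, which is used for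
[k > j]. Since [1 < u <= p], both are at most [q ^+ k * u ^+ j / u ^+ k] up to
powers of [y], which is a geometric bound of the kind needed to pass from
nonbacktracking paths to walks. *)
Lemma sphere_walk_le u y : 1 < u <= p -> 1 < y <= u -> s < p * (y + y^-1) ->
  exists2 C : R, 0 <= C & forall j n,
  walk_sum n (fun x => (dist x == j)%:R) o <= C * (u * y) ^+ j * (q * (y / u) + u / y) ^+ n.
Proof.
move=> /andP[u1 up] /andP[y1 yu] sy; have [C C0 nbC] := nb_nb_le y1 sy.
have u0 : 0 < u by apply: lt_trans u1.
have y0 : 0 < y by apply: lt_trans y1.
have q0 : 0 < q by move: q_ge2; lra.
exists (2 + C) => [|j n]; first by rewrite addr_ge0.
rewrite -[u / y]invf_div.
apply: walk_sum_le_of_nb; first by rewrite divr_gt0//= ler_pdivrMr// mul1r.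
  by rewrite mulr_ge0 ?addr_ge0// exprn_ge0// mulr_ge0// ltW.
move=> k; rewrite [(q * _) ^+ k]exprMn.
have pos1 a : 0 < (u * y) ^+ a by rewrite exprn_gt0// mulr_gt0.
have pos2 a : 0 < (y / u) ^+ a by rewrite exprn_gt0// divr_gt0.
have [kj|jk] := leqP k j.
  apply: (@le_trans _ _ (2 * q ^+ k)).
    by apply: (nb_le_pow Gd) => // x; rewrite lern1 leq_b1.
  rewrite -!mulrA ler_pM ?exprn_ge0 ?(ltW q0)//; first by rewrite lerDl.
  rewrite mulrCA ler_peMr ?exprn_ge0 ?(ltW q0)//.
  rewrite -(subnK kj) exprD -mulrA -exprMn.
  rewrite (_ : u * y * (y / u) = y * y); last by field; rewrite gt_eqF.
  by rewrite mulr_ege1// exprn_ege1// mulr_ege1// ltW.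
have : nb_sum k (fun x => (dist x == j)%:R) o <= C * (p * y) ^+ (j + k).
  by apply: le_trans (nbC j k); apply: le_nb => x; apply: sphere_le_nb.
move/le_trans; apply.
rewrite -!mulrA; apply: ler_pM => //; first by rewrite exprn_ge0// mulr_ge0// ltW.
  by rewrite lerDr.
rewrite /q -p2 -(subnKC (ltnW jk)); set a := (k - j)%N.
have -> : (p * y) ^+ (j + (j + a)) =
    (p ^+ j * p ^+ j * y ^+ j * y ^+ j * (p ^+ a * p ^+ a * y ^+ a)) * (p ^+ a)^-1.
  rewrite !exprMn !exprD; field; rewrite expf_neq0// gt_eqF//.
have -> : (u * y) ^+ j * ((p ^+ 2) ^+ (j + a) * (y / u) ^+ (j + a)) =
    (p ^+ j * p ^+ j * y ^+ j * y ^+ j * (p ^+ a * p ^+ a * y ^+ a)) * (u ^+ a)^-1.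
  rewrite [(u * y) ^+ j]exprMn [(y / u) ^+ _]exprMn exprVn exprAC expr2 !exprD; field.
  by rewrite !expf_neq0// gt_eqF//.
have p0 : 0 <= p by apply: ltW.
rewrite ler_wpM2l ?mulr_ge0 ?exprn_ge0 ?(ltW y0)//.
by rewrite lef_pV2 ?posrE ?exprn_gt0// lerXn2r ?nnegrE// ltW.
Qed.

End Sphere.
End Distance.

(** * Walks and trivial cycles *)

Section Walks.
Variable G : multigraph.
Implicit Types (x : vertex G) (e f : edge G) (s t : seq (edge G)).

Fixpoint is_walk x s : bool :=
  if s is e :: s' then (tail e == x) && is_walk (head e) s' else true.

Definition endpoint x s := last x (map (@head G) s).

Lemma is_walk_cat x s t :
  is_walk x (s ++ t) = is_walk x s && is_walk (endpoint x s) t.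
Proof. by elim: s x => //= e s IH x; rewrite IH andbA. Qed.

Lemma endpoint_cat x s t : endpoint x (s ++ t) = endpoint (endpoint x s) t.
Proof. by rewrite /endpoint map_cat last_cat. Qed.

Lemma path_adjE e s : path (@adj G) e s = is_walk (head e) s.
Proof. by elim: s e => //= f s IH e; rewrite IH /adj eq_sym. Qed.

Lemma cycle_adjE e s : cycle (@adj G) (e :: s) =
  is_walk (tail e) (e :: s) && (endpoint (tail e) (e :: s) == tail e).
Proof.
rewrite /= rcons_path path_adjE eqxx /=; congr (_ && _).
by rewrite /adj /endpoint /= last_map.
Qed.

Lemma erases_trans s t u : erases s t -> erases t u -> erases s u.
Proof. by elim=> // s1 e s2 t' _ IH /IH; apply: erases_backtrack. Qed.

Lemma erases_context a b s t : erases s t -> erases (a ++ s ++ b) (a ++ t ++ b).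
Proof.
elim=> [s'|s1 e s2 t' _ IH]; first exact: erases_refl.
by rewrite -catA catA /=; apply: erases_backtrack; rewrite -catA (catA s1).
Qed.

(** A level function [D] is fixed, such as the distance from [o]. A vertex is
regular when it has at most one edge that does not go up, that edge going down,
as is the case for every vertex of a tree. A closed walk through regular
vertices only behaves as in a tree: it backtracks at its highest vertices. *)
Section Levels.
Variable D : vertex G -> nat.
Hypothesis D_parent : forall x, (0 < D x)%N ->
  exists2 e, tail e = x & (D (head e) < D x)%N.

Definition nonascending x : nat :=
  count (fun e => (D (head e) <= D x)%N) (out_edges x).

Definition irregular x : bool := ((0 < D x) < nonascending x)%N.

Lemma regular_unique e f : ~~ irregular (tail e) -> tail f = tail e ->
  (D (head e) <= D (tail e))%N -> (D (head f) <= D (tail e))%N -> e = f.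
Proof.
move=> reg fe De Df; apply/eqP; apply: contraNT reg => ef.
rewrite /irregular /nonascending -size_filter.
apply: (@leq_trans 2); first by case: (0 < D _)%N.
rewrite (@uniq_leq_size _ [:: e; f])//= ?inE ?ef// => g.
by rewrite !inE mem_filter => /orP[] /eqP->; rewrite mem_out_edges ?fe eqxx andbT.
Qed.

Lemma regular_no_loop e : ~~ irregular (tail e) -> head e <> tail e.
Proof.
move=> reg loop; have De : (D (head e) <= D (tail e))%N by rewrite loop.
case: (ltnP 0 (D (tail e))) => [/D_parent[f fe Df]|].
  by have ef := regular_unique reg fe De (ltnW Df); move: Df; rewrite -ef loop ltnn.
rewrite leqn0 => /eqP D0; move: reg; rewrite /irregular D0 ltnn -leqNgt leqn0.
rewrite -leqn0 leqNgt -has_count => /hasP; apply.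
by exists e; rewrite ?mem_out_edges.
Qed.

(* A failure of [no_peak e f] is a weak local maximum of the level between [e]
   and [f]; both edges then lead from it to vertices that are not higher. *)
Let no_peak e f := (D (tail e) <= D (head e))%N ==> (D (tail f) < D (head f))%N.

Lemma no_peak_up e s : path no_peak e s -> is_walk (head e) s ->
  (D (tail e) <= D (head e))%N ->
  (D (head e) + size s <= D (endpoint (head e) s))%N.
Proof.
elim: s e => [|f s IH] e /=; first by rewrite addn0.
move=> /andP[/implyP ef pf] /andP[/eqP fe wf] up.
rewrite /endpoint /= -/(endpoint _ _); apply: leq_trans (IH f pf wf (ltnW (ef up))).
by rewrite addnS -addSn leq_add2r -fe ef.
Qed.

Lemma no_peak_down e s f : path no_peak e (rcons s f) ->
  is_walk (head e) (rcons s f) -> (D (head f) <= D (tail f))%N ->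
  (D (head e) < D (tail e))%N /\ (D (tail f) <= D (head e))%N.
Proof.
elim: s e => [|g s IH] e /=.
  rewrite !andbT => /implyP ef /eqP fe Df; split; last by rewrite fe.
  by rewrite ltnNge; apply/negP => /ef; rewrite ltnNge Df.
move=> /andP[/implyP eg pg] /andP[/eqP ge wg] Df; have [gd fg] := IH g pg wg Df.
split; first by rewrite ltnNge; apply/negP => /eg; rewrite ltnNge ltnW.
by rewrite -ge (leq_trans fg)// ltnW.
Qed.

Lemma not_path_split (T : Type) (r : rel T) (a : T) l : ~~ path r a l ->
  exists l1 b c l2, a :: l = l1 ++ [:: b, c & l2] /\ ~~ r b c.
Proof.
elim: l a => //= c l IH a; rewrite negb_and => /orP[ac|/IH].
  by exists [::], a, c, l.
by move=> [l1 [b [c' [l2 [-> bc]]]]]; exists (a :: l1), b, c', l2.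
Qed.

(** Induction on the length. At a weak local maximum inside the walk, both
adjacent edges are non-ascending edges of a regular vertex, so they are inverse
to each other and can be erased. Without such a maximum the levels first
decrease and then increase, so the walk leaves [x] and comes back to [x] along
its only non-ascending edge, and the part in between is a shorter closed walk. *)
Lemma regular_closed_erases x s : is_walk x s -> endpoint x s = x ->
  all (fun e => ~~ irregular (tail e)) s -> erases s [::].
Proof.
have [n] := ubnP (size s); elim: n x s => // n IH x [|e s] sz.
  by move=> *; apply: erases_refl.
rewrite /= in sz *; move=> w_s end_s reg_s.
have [np|np] := boolP (path no_peak e s); last first.
  have [s1 [a [b [s2 [es peak]]]]] := not_path_split np.
  move: peak; rewrite negb_imply -leqNgt => /andP[up down].
  have w : is_walk x (e :: s) by [].
  have en : endpoint x (e :: s) = x by [].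
  have reg : all (fun e => ~~ irregular (tail e)) (e :: s) by [].
  have sz' : (size (e :: s) < n.+1)%N by [].
  move: w en reg sz'; rewrite es; clear w_s end_s reg_s es sz np.
  rewrite is_walk_cat endpoint_cat all_cat size_cat /= => /andP[w1].
  move=> /and3P[/eqP ta /eqP tb w2] en /andP[reg1 /and3P[rega regb reg2]] sz'.
  have ba : b = rev a.
    apply: (regular_unique regb) => //; first by rewrite tail_rev.
    by rewrite head_rev tb.
  rewrite ba; apply: erases_backtrack; apply: (IH x).
  - by rewrite size_cat; lia.
  - by rewrite is_walk_cat w1 -ta -head_rev -ba.
  - by rewrite endpoint_cat -[RHS]en /endpoint /= ba head_rev ta.
  - by rewrite all_cat reg1.
move: w_s reg_s => /andP[/eqP ex w_s] /andP[rege reg_s].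
have end_s' : endpoint (head e) s = x by [].
have downe : (D (head e) < D x)%N.
  rewrite ltnNge; apply/negP => up.
  have := no_peak_up np w_s; rewrite ex => /(_ up); rewrite end_s'.
  case: s {sz np w_s end_s reg_s} end_s' => [he _|f s _ h]; last by move: h up => /=; lia.
  by apply: (regular_no_loop rege); rewrite ex -he.
case/lastP: s sz np w_s end_s end_s' reg_s => [|s f].
  by move=> _ _ _ _ he; rewrite -he ltnn in downe.
rewrite size_rcons => sz np w_s _ end_s reg_s.
have hf : head f = x by move: end_s; rewrite /endpoint map_rcons last_rcons.
have [wf1 wf2] : is_walk (head e) s /\ endpoint (head e) s = tail f.
  by move: w_s; rewrite -cats1 is_walk_cat /= andbT => /andP[-> /eqP].
have downf : (D (tail f) <= D x)%N.
  rewrite leqNgt; apply/negP => upf.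
  have [|_ h] := no_peak_down np w_s; first by rewrite hf ltnW.
  by move: (leq_ltn_trans h downe) upf; lia.
have fe : e = rev f.
  apply: (regular_unique rege); rewrite ?tail_rev ?head_rev ?ex ?hf//.
  exact: ltnW.
have f_rev : f = rev e by rewrite fe revK.
rewrite f_rev -cats1 -cat1s.
apply: erases_trans (erases_context [:: e] [:: rev e] (_ : erases s [::])) _.
  apply: (IH (head e)) => //; first by rewrite -ltnS; apply: leq_trans sz.
    by rewrite wf2 f_rev tail_rev.
  by move: reg_s; rewrite all_rcons => /andP[].
by apply: (@erases_backtrack _ [::] e [::]); apply: erases_refl.
Qed.

Lemma nontrivial_cycle_irregular s : nontrivial_cycle s ->
  has (fun e => irregular (tail e)) s.
Proof.
case: s => [[[]]//|e s] [[_ cyc] nt].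
move: cyc; rewrite cycle_adjE => /andP[w /eqP en].
apply/negPn/negP; rewrite -all_predC => reg; apply: nt.
exact: regular_closed_erases w en reg.
Qed.

End Levels.
End Walks.

(** * Averages over walks and an exponential moment *)

Section PathExpectation.
Variables (R : realType) (G : multigraph) (d : nat).
Implicit Types (x : vertex G) (e : edge G) (s : seq (edge G)) (m n : nat).
Implicit Types (g : seq (edge G) -> R).

(** The expectation of a function of the first [n] edges of simple random walk
from [x], on a [d]-regular graph. *)
Fixpoint walk_mean n x g : R :=
  if n is m.+1 then
    d%:R^-1 * \sum_(e <- out_edges x) walk_mean m (head e) (fun s => g (e :: s))
  else g [::].

Lemma le_walk_mean n x g g' :
  (forall s, size s = n -> is_walk x s -> g s <= g' s) ->
  walk_mean n x g <= walk_mean n x g'.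
Proof.
elim: n x g g' => [|n IH] x g g' gg' /=; first exact: gg'.
rewrite ler_wpM2l ?invr_ge0//; apply: ler_out => e xe; apply: IH => s sn ws.
by apply: gg' => /=; rewrite ?sn ?xe ?eqxx.
Qed.

Lemma walk_meanZ n x (c : R) g : walk_mean n x (fun s => c * g s) = c * walk_mean n x g.
Proof.
elim: n x g => //= n IH x g; under eq_bigr do rewrite IH.
by rewrite -mulr_sumr mulrCA.
Qed.

Lemma walk_meanD n x g g' :
  walk_mean n x (fun s => g s + g' s) = walk_mean n x g + walk_mean n x g'.
Proof.
elim: n x g g' => //= n IH x g g'; under eq_bigr do rewrite IH.
by rewrite big_split mulrDr.
Qed.

Lemma walk_mean0 n x : walk_mean n x (fun=> 0) = 0.
Proof. by elim: n x => //= n IH x; under eq_bigr do rewrite IH; rewrite big1 ?mulr0. Qed.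

Lemma walk_mean_sum n x k (g : nat -> seq (edge G) -> R) :
  walk_mean n x (fun s => \sum_(i < k) g i s) = \sum_(i < k) walk_mean n x (g i).
Proof.
elim: k => [|k IH].
  by rewrite big_ord0 -[RHS](walk_mean0 n x); congr walk_mean; apply/funext => s; rewrite big_ord0.
rewrite big_ord_recr /= -IH -walk_meanD; congr walk_mean; apply/funext => s.
by rewrite big_ord_recr.
Qed.

Lemma walk_mean_ge0 n x g : (forall s, 0 <= g s) -> 0 <= walk_mean n x g.
Proof. by move=> g0; rewrite -[leLHS](walk_mean0 n x); apply: le_walk_mean. Qed.

Lemma walk_mean_cat m n x g : walk_mean (m + n) x g =
  walk_mean m x (fun s => walk_mean n (endpoint x s) (fun t => g (s ++ t))).
Proof.
elim: m x g => //= m IH x g; congr (_ * _); apply: eq_bigr => e _.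
by rewrite IH.
Qed.

Lemma walk_mean_endpoint n x (f : vertex G -> R) :
  walk_mean n x (fun s => f (endpoint x s)) = walk_sum n f x / d%:R ^+ n.
Proof.
elim: n x => [|n IH] x /=; first by rewrite expr0 divr1.
under eq_bigr do rewrite (IH (head _)).
by rewrite -mulr_suml exprSr invfM mulrC -mulrA.
Qed.

Lemma walk_meanS n x g : walk_mean n.+1 x g =
  d%:R^-1 * \sum_(e <- out_edges x) walk_mean n (head e) (fun s => g (e :: s)).
Proof. by []. Qed.

Hypothesis Gd : regular G d.
Hypothesis d_gt0 : (0 < d)%N.

Lemma walk_mean_cst n x (c : R) : walk_mean n x (fun=> c) = c.
Proof.
elim: n x => //= n IH x; under eq_bigr do rewrite IH.
by rewrite sum_out_const Gd mulrA mulVf ?mul1r// pnatr_eq0 -lt0n.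
Qed.

End PathExpectation.
#[global] Arguments walk_mean : simpl never.

(** Away from level 0, the level of the walk has drift at most
[(q - 1) / (q + 1)], as on the tree, and irregular vertices lower it. To make this quantitative,
the level is fed to a function that the walk on the tree would multiply by [kap]
on average at every step. *)
Section ExponentialMoment.
Variables (R : realType) (G : multigraph) (d : nat).
Hypotheses (Gd : regular G d) (d3 : (3 <= d)%N).
Variable D : vertex G -> nat.
Hypothesis D_head : forall e, (D (head e) <= (D (tail e)).+1)%N.
Hypothesis D_parent : forall x, (0 < D x)%N ->
  exists2 e, tail e = x & (D (head e) < D x)%N.
Variable u : R.
Hypothesis u_gt1 : 1 < u.
Let q : R := d%:R - 1.
Let kap := (q * u + u^-1) / d%:R.

Let q_ge2 : 2 <= q.
Proof. have h : (3%:R : R) <= d%:R by rewrite ler_nat.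
by rewrite /q; lra. Qed.

Let dE : d%:R = q + 1. Proof. by rewrite /q subrK. Qed.
Let d_gt0 : 0 < d%:R :> R. Proof. by rewrite ltr0n; lia. Qed.
Let u_gt0 : 0 < u. Proof. exact: lt_trans u_gt1. Qed.
Let uV_lt1 : u^-1 < 1. Proof. by rewrite invf_lt1. Qed.
Let uV_gt0 : 0 < u^-1. Proof. by rewrite invr_gt0. Qed.

Let kap1E : kap - 1 = (u - 1) * (q - u^-1) / d%:R.
Proof. by rewrite /kap dE; field; rewrite -dE !gt_eqF. Qed.

Let kap_ge1 : 1 <= kap.
Proof.
rewrite -subr_ge0 kap1E divr_ge0 ?ler0n// mulr_ge0 ?subr_ge0 ?(ltW u_gt1)//.
by move: q_ge2 uV_lt1; lra.
Qed.

(** The radial eigenfunction of the transition operator of the [d]-regular tree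
with eigenvalue [kap], normalized to 1 at the root. The plain exponential
[u ^+ k] has the same eigenvalue away from the root, but at the root the
inequality that is needed would fail. *)
Fixpoint spherical k : R :=
  if k is k'.+1 then
    if k' is k''.+1 then (d%:R * kap * spherical k' - spherical k'') / q
    else kap
  else 1.

Lemma sphericalSS k :
  q * spherical k.+2 = d%:R * kap * spherical k.+1 - spherical k.
Proof. by rewrite /=; field; rewrite gt_eqF//; move: q_ge2; lra. Qed.

Lemma spherical_growth k : 0 < spherical k /\ kap * spherical k <= spherical k.+1.
Proof.
elim: k => [|k [s0 sS]]; first by rewrite /= mulr1.
have kap0 : 0 < kap by apply: lt_le_trans kap_ge1.
have sS0 : 0 < spherical k.+1 by apply: lt_le_trans sS; rewrite mulr_gt0.
split => //; have q0 : 0 < q by move: q_ge2; lra.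
rewrite -(ler_pM2l q0) sphericalSS dE.
have : spherical k <= kap * spherical k by rewrite ler_peMl// ltW.
have : spherical k.+1 <= kap * spherical k.+1 by rewrite ler_peMl// ltW.
move: sS; move: (kap * spherical k) => A.
have -> : (q + 1) * kap * spherical k.+1 = q * (kap * spherical k.+1) + kap * spherical k.+1 by ring.
move: (kap * spherical k.+1) => B; lra.
Qed.

Lemma spherical_le i j : (i <= j)%N -> spherical i <= spherical j.
Proof.
move=> /subnKC <-; elim: (j - i)%N => [|n IH]; first by rewrite addn0.
rewrite addnS; have [s0 sS] := spherical_growth (i + n).
by apply: le_trans IH (le_trans _ sS); rewrite ler_peMl// ltW.
Qed.

(** [u ^+ k] and [(q * u) ^- k] are the two solutions of the recursion; the
combination that eliminates the second one is geometric. *)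
Lemma spherical_lower : exists2 K, 0 <= K & forall k, u ^+ k <= K * spherical k.
Proof.
set c := kap - (q * u)^-1.
have q0 : 0 < q by move: q_ge2; lra.
have qu : (q * u)^-1 < 1 by rewrite invf_lt1 ?mulr_gt0// mulr_egt1//; move: q_ge2; lra.
have c0 : 0 < c by rewrite /c; move: kap_ge1 qu; lra.
have step k : spherical k.+1 - spherical k / (q * u) = c * u ^+ k.
  elim: k => [|k IH]; first by rewrite /c /= expr0 mulr1 mul1r.
  rewrite exprSr mulrA -IH; have := sphericalSS k.
  have -> : d%:R * kap = q * u + u^-1 by rewrite /kap mulrC divfK// gt_eqF.
  move: (spherical k.+2) (spherical k.+1) (spherical k) => a b e h.
  have -> : a = (q * a) / q by field; rewrite gt_eqF.
  by rewrite h; field; rewrite !gt_eqF.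
exists (1 + u / c) => [|k]; first by rewrite addr_ge0// divr_ge0// ltW.
case: k => [|k]; first by rewrite expr0 mulr1 lerDl divr_ge0// ltW.
have [s0 _] := spherical_growth k.+1; have [s0' _] := spherical_growth k.
rewrite mulrDl mul1r -[leLHS]add0r lerD ?(ltW s0)//.
rewrite exprS -mulrA ler_pM2l// mulrC ler_pdivlMr// mulrC -step gerBl.
by rewrite divr_ge0 ?(ltW s0')// mulr_ge0// ltW.
Qed.

Let sum_at (x : vertex G) (e0 : edge G) (c : R) : tail e0 = x ->
  \sum_(e <- out_edges x) (e == e0)%:R * c = c.
Proof.
move=> xe0; rewrite (big_fsetD1 e0) ?mem_out_edges ?xe0//= eqxx mul1r big1_seq ?addr0//.
by move=> e /=; rewrite !inE => /andP[/negbTE-> _]; rewrite mul0r.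
Qed.

(** On the tree this is an equality, with one neighbor below and all others
above. An irregular vertex has one more neighbor that is not above, and loses
at least [spherical (D x).+1 - spherical (D x)]. *)
Lemma nbr_sum_spherical x : nbr_sum (fun y => spherical (D y)) x <=
  (d%:R * kap - (irregular D x)%:R * (kap - 1)) * spherical (D x).
Proof.
have up e : tail e = x -> spherical (D (head e)) <= spherical (D x).+1.
  by move=> xe; apply: spherical_le; rewrite -xe.
have [s0 sS] := spherical_growth (D x).
have gap : (irregular D x)%:R * (kap - 1) * spherical (D x) <=
     (irregular D x)%:R * (spherical (D x).+1 - spherical (D x)).
  by rewrite -mulrA ler_wpM2l ?ler0n// mulrBl mul1r lerB.
rewrite [leRHS]mulrBl; apply: le_trans _ (lerB (lexx _) gap).
case: (posnP (D x)) => [D0|Dx].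
  rewrite D0 /= mulr1; case: (boolP (irregular D x)) => irr; last first.
    rewrite mul0r subr0 -(Gd x) -sum_out_const; apply: ler_out => e /up.
    by rewrite D0.
  have [e1 xe1 De1] : exists2 e, tail e = x & (D (head e) <= D x)%N.
    move: irr; rewrite /irregular D0 ltnn /nonascending -has_count => /hasP[e].
    by rewrite mem_out_edges => /eqP he De; exists e => //; rewrite -D0.
  rewrite mul1r -(Gd x) -(sum_out_const x) -(sum_at (kap - 1) xe1) -sumrB.
  apply: ler_out => e xe; have [->|_] := eqVneq e e1.
    by move: De1; rewrite D0 leqn0 => /eqP ->; rewrite mul1r /= subKr.
  by rewrite mul0r subr0; have := up e xe; rewrite D0.
have [e0 xe0 De0] := D_parent Dx.
have -> : d%:R * kap * spherical (D x) = d%:R * spherical (D x).+1 -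
    (spherical (D x).+1 - spherical (D x).-1).
  by move: (sphericalSS (D x).-1); rewrite prednK// dE; lra.
have e0_le : spherical (D (head e0)) <= spherical (D x).-1.
  by apply: spherical_le; rewrite -ltnS prednK.
case: (boolP (irregular D x)) => irr; last first.
  rewrite mul0r subr0 -(Gd x) -(sum_out_const x).
  rewrite -(sum_at (spherical (D x).+1 - spherical (D x).-1) xe0) -sumrB.
  apply: ler_out => e xe; have [->|_] := eqVneq e e0.
    by rewrite mul1r subKr.
  by rewrite mul0r subr0 up.
have [e1 [xe1 De1 e10]] : exists e1, [/\ tail e1 = x, (D (head e1) <= D x)%N & e1 != e0].
  apply: contrapT => none; move: irr; rewrite /irregular Dx /nonascending -size_filter.
  apply/negP; rewrite -leqNgt (@uniq_leq_size _ _ [:: e0]) ?filter_uniq//.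
  move=> e; rewrite mem_filter mem_out_edges inE => /andP[De /eqP xe].
  by apply/negPn/negP => ee0; apply: none; exists e.
rewrite mul1r -(Gd x) -(sum_out_const x).
rewrite -(sum_at (spherical (D x).+1 - spherical (D x).-1) xe0).
rewrite -(sum_at (spherical (D x).+1 - spherical (D x)) xe1) -!sumrB.
apply: ler_out => e xe; have [->|_] := eqVneq e e0.
  by rewrite eq_sym (negbTE e10) mul1r mul0r subr0 subKr.
rewrite mul0r subr0; have [->|_] := eqVneq e e1; last by rewrite mul0r subr0 up.
by rewrite mul1r subKr spherical_le.
Qed.

Definition irregular_count (s : seq (edge G)) := count (fun e => irregular D (tail e)) s.

(** The reward [r] for each irregular vertex visited is small enough to be paid
for by the loss there. *)
Lemma exponential_moment (r : R) n x : 1 <= r ->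
  r * (kap - (kap - 1) / d%:R) <= kap ->
  walk_mean d n x (fun s => r ^+ irregular_count s * spherical (D (endpoint x s)))
    <= kap ^+ n * spherical (D x).
Proof.
move=> r1 rk; elim: n x => [|n IH] x; first by rewrite /walk_mean /= !expr0.
rewrite walk_meanS.
have kap0 : 0 <= kap by apply: le_trans kap_ge1.
have -> : \sum_(e <- out_edges x) walk_mean d n (head e)
     (fun s => r ^+ irregular_count (e :: s) * spherical (D (endpoint x (e :: s)))) =
  \sum_(e <- out_edges x) r ^+ irregular D x * walk_mean d n (head e)
     (fun s => r ^+ irregular_count s * spherical (D (endpoint (head e) s))).
  apply: eq_out => e xe; rewrite -walk_meanZ; congr walk_mean; apply/funext => s.
  by rewrite /irregular_count /= xe exprD -mulrA.
rewrite -mulr_sumr.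
have Hs : \sum_(e <- out_edges x) walk_mean d n (head e)
     (fun s => r ^+ irregular_count s * spherical (D (endpoint (head e) s))) <=
   kap ^+ n * ((d%:R * kap - (irregular D x)%:R * (kap - 1)) * spherical (D x)).
  apply: le_trans (ler_wpM2l (exprn_ge0 n kap0) (nbr_sum_spherical x)).
  by rewrite /nbr_sum mulr_sumr; apply: ler_sum => e _; apply: IH.
have [s0 _] := spherical_growth (D x).
apply: le_trans (ler_wpM2l _ (ler_wpM2l _ Hs)) _.
- by rewrite invr_ge0.
- by rewrite exprn_ge0// (le_trans _ r1).
rewrite exprSr.
have -> : d%:R^-1 * (r ^+ irregular D x * (kap ^+ n *
    ((d%:R * kap - (irregular D x)%:R * (kap - 1)) * spherical (D x)))) =
  kap ^+ n * (r ^+ irregular D x *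
     (kap - (irregular D x)%:R * ((kap - 1) / d%:R)) * spherical (D x)).
  by field; rewrite gt_eqF.
rewrite -[leRHS]mulrA ler_wpM2l ?exprn_ge0// ler_wpM2r ?(ltW s0)//.
by case: (irregular D x); rewrite /= ?expr1 ?mul1r ?expr0 ?mul0r ?subr0 ?mul1r.
Qed.

End ExponentialMoment.

(** * Choice of the tilting parameters *)

Lemma bernoulli_le (R : realFieldType) (a : R) k : 0 <= a -> 2 * k%:R * a <= 1 ->
  (1 + a) ^+ k <= 1 + 2 * k%:R * a.
Proof.
move=> a0; elim: k => [|k IH] ka; first by rewrite expr0 mulr0 mul0r addr0.
have ka1 : 2 * k%:R * a <= 1 by move: ka; rewrite -[k.+1%:R]natr1; nra.
have k0 : 0 <= k%:R :> R by [].
rewrite exprSr; apply: le_trans (ler_wpM2r _ (IH ka1)) _; first by rewrite addr_ge0.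
rewrite -[k.+1%:R]natr1; move: ka1 k0; move: (k%:R) => z h z0.
have -> : (1 + 2 * z * a) * (1 + a) = 1 + 2 * z * a + a + (2 * z * a) * a by ring.
have : (2 * z * a) * a <= 1 * a by rewrite ler_wpM2r.
by lra.
Qed.

Lemma ge_bernoulli (R : realFieldType) (a : R) k : 0 <= a -> 1 + k%:R * a <= (1 + a) ^+ k.
Proof.
move=> a0; elim: k => [|k IH]; first by rewrite expr0 mul0r addr0.
rewrite exprSr; apply: le_trans (ler_wpM2r _ IH); last by rewrite addr_ge0.
have : 0 <= k%:R * a * a by rewrite !mulr_ge0.
by rewrite -natr1; lra.
Qed.

Lemma linear_le_pow (R : realFieldType) (y : R) n : 1 < y ->
  n.+1%:R <= (1 + (y - 1)^-1) * y ^+ n.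
Proof.
move=> y1; have y10 : 0 < y - 1 by lra.
have h := ge_bernoulli n (ltW y10).
have yE : 1 + (y - 1) = y by lra.
rewrite yE in h.
have -> : y ^+ n = (y - 1) * (y ^+ n / (y - 1)) by field; rewrite gt_eqF.
have -> : (1 + (y - 1)^-1) * ((y - 1) * (y ^+ n / (y - 1))) = y ^+ n + y ^+ n / (y - 1).
  by field; rewrite gt_eqF.
rewrite -natr1 addrC lerD//.
  by apply: le_trans h; rewrite lerDl mulr_ge0// ltW.
rewrite ler_pdivlMr//; lra.
Qed.

(** With [u = 1 + w], the reward [r] may exceed 1 by an amount of order [w],
whereas [kap u] times the growth rate [(q / u + u) / (q + 1)] of the other bound
exceeds 1 only by an amount of order [w ^+ 2], because the two rates are
eigenvalues of the tree with inverse parameters. So for small [w] an [m]th root of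
the reward beats their product, even with some room for powers of [y]. *)
Lemma tilting_parameters (R : realFieldType) (q p : R) (m : nat) :
  2 <= q -> p ^+ 2 = q -> 0 < p -> (0 < m)%N ->
  let kap u := (q * u + u^-1) / (q + 1) in
  exists u y r r0 : R,
  [/\ 1 < u <= p, 1 < y <= u, 1 <= r & 1 <= r0] /\
  [/\ r0 ^+ m <= r, r * (kap u - (kap u - 1) / (q + 1)) <= kap u
    & y ^+ 2 * (y * ((q * (y / u) + u / y) / (q + 1)) * kap u) < r0].
Proof.
move=> q2 pq p0 m0 kap.
set dd := q + 1; set M : R := m%:R.
have M1 : 1 <= M by rewrite ler1n.
have dd3 : 3 <= dd by rewrite /dd; lra.
set A := 4 * dd ^+ 2 * M.
have A1 : 36 <= A.
  have : 9 <= dd ^+ 2 by rewrite expr2; nra.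
  by rewrite /A; move: (dd ^+ 2) => z hz; nra.
have A0 : 0 < A by lra.
set w := (8 * A)^-1.
have w0 : 0 < w by rewrite invr_gt0; lra.
have wA : w * A = 8^-1 by rewrite /w; field; rewrite gt_eqF.
have w1 : w <= 8^-1.
  by rewrite -wA ler_peMr ?(ltW w0)//; lra.
set u := 1 + w; set a := w / (32 * A); set y := 1 + a.
have a0 : 0 < a by rewrite divr_gt0// mulr_gt0.
have aA : 32 * (a * A) = w by rewrite /a; field; rewrite gt_eqF.
have aw : a <= w.
  have : a * 1 <= a * A by rewrite ler_pM2l//; lra.
  by lra.
have u0 : 0 < u by rewrite /u; lra.
have y0 : 0 < y by rewrite /y; lra.
set v := u^-1; have uv : u * v = 1 by rewrite /v divff// gt_eqF.
have v0 : 0 < v by rewrite invr_gt0.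
have v1 : v <= 1 by rewrite /v invf_le1// /u; lra.
have dd0 : 0 < dd by lra.
have kapE : kap u * dd = q * u + v by rewrite /kap divfK// gt_eqF.
have kap1E : (kap u - 1) * dd = w * (q - v).
  rewrite mulrBl kapE /dd.
  have -> : w * (q - v) = q * (1 + w) - q - (u * v - v) by rewrite /u; ring.
  by rewrite uv -/u; ring.
have kap_le : kap u <= u.
  have uq : u * dd = q * u + u by rewrite /dd; ring.
  by rewrite -(ler_pM2r dd0) kapE uq lerD2l /u; lra.
have kap1_ge : w <= (kap u - 1) * dd.
  by rewrite kap1E ler_peMr ?(ltW w0)//; lra.
exists u, y, (1 + w / (2 * dd ^+ 2)), (1 + w / A).
have dd2 : 0 < dd ^+ 2 by rewrite exprn_gt0.
have wdd0 : 0 < w / (2 * dd ^+ 2) by rewrite divr_gt0// mulr_gt0.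
have wA0 : 0 < w / A by rewrite divr_gt0.
split; split.
- rewrite /u; apply/andP; split; first by lra.
  rewrite -(ler_pXn2r (_ : (0 < 2)%N)) ?nnegrE ?(ltW p0)//; last by lra.
  rewrite pq; apply: le_trans q2; rewrite expr2; nra.
- by rewrite /y /u; apply/andP; split; lra.
- by lra.
- by lra.
- have -> : w / (2 * dd ^+ 2) = 2 * M * (w / A).
    by rewrite /A; field; rewrite !gt_eqF//; lra.
  apply: bernoulli_le; first by rewrite ltW.
  have -> : 2 * m%:R * (w / A) = w / (2 * dd ^+ 2).
    by rewrite /A -/M; field; rewrite !gt_eqF//; lra.
  rewrite ler_pdivrMr ?mulr_gt0// mul1r.
  have : 9 <= dd ^+ 2 by rewrite expr2; nra.
  by move: (dd ^+ 2) => z hz; lra.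
- suff : w / (2 * dd ^+ 2) * (kap u - (kap u - 1) / dd) <= (kap u - 1) / dd.
    by rewrite -/dd; move: (w / (2 * dd ^+ 2)) ((kap u - 1) / dd) => b c; lra.
  have k0 : 0 <= kap u - 1.
    by rewrite -(pmulr_lge0 _ dd0); lra.
  apply: (@le_trans _ _ (w / (2 * dd ^+ 2) * 2)).
    rewrite ler_wpM2l ?(ltW wdd0)//.
    have : 0 <= (kap u - 1) / dd by rewrite divr_ge0// ltW.
    by rewrite /u in kap_le *; lra.
  rewrite ler_pdivlMr//.
  have -> : w / (2 * dd ^+ 2) * 2 * dd = w / dd by field; rewrite gt_eqF.
  by rewrite ler_pdivrMr.
- set lam0 := (q * v + u) / dd.
  have lam_le : (q * (y / u) + u / y) / dd <= y * lam0.
    have -> : y * lam0 = (y * (q * v) + y * u) / dd.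
      by rewrite /lam0; field; rewrite gt_eqF.
    rewrite ler_pM2r ?invr_gt0// -/v.
    have -> : q * (y * v) = y * (q * v) by ring.
    rewrite lerD2l [y * u]mulrC ler_wpM2l ?(ltW u0)//.
    have y1 : 1 <= y by rewrite /y; lra.
    by rewrite (@le_trans _ _ 1)// invf_le1.
  have kap0 : 0 < kap u.
    by rewrite -(pmulr_lgt0 _ dd0) kapE addr_gt0// mulr_gt0//; lra.
  have L_le : lam0 * kap u <= 1 + 4 * w ^+ 2.
    have -> : lam0 * kap u = 1 + q / dd ^+ 2 * (u - v) ^+ 2.
      rewrite /lam0 /kap -/dd -/v.
      have -> : (q * v + u) / dd * ((q * u + v) / dd) =
        (q ^+ 2 * (u * v) + q * (u ^+ 2 + v ^+ 2) + u * v) / dd ^+ 2.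
        by field; rewrite gt_eqF.
      have -> : (u - v) ^+ 2 = u ^+ 2 + v ^+ 2 - 2 * (u * v) by ring.
      by rewrite uv /dd; field; rewrite gt_eqF.
    rewrite lerD2l.
    have q1 : q / dd ^+ 2 <= 1.
      by rewrite ler_pdivrMr// mul1r expr2 /dd; nra.
    have uvw : u - v <= 2 * w.
      have : v * w <= w by rewrite ler_piMl// ltW.
      have : (1 + w) * v = 1 by [].
      by rewrite /u; lra.
    have uv0 : 0 <= u - v by rewrite /u; lra.
    have -> : 4 * w ^+ 2 = 1 * (2 * w) ^+ 2 by ring.
    apply: ler_pM => //; rewrite ?sqr_ge0//.
      by rewrite divr_ge0 ?(ltW dd2)//; lra.
    by rewrite lerXn2r ?nnegrE//; lra.
  have y4 : y ^+ 4 <= 1 + 2 * 4%:R * a.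
    by apply: bernoulli_le; [exact: ltW|lra].
  apply: (@le_lt_trans _ _ (y ^+ 4 * (lam0 * kap u))).
    have -> : y ^+ 4 * (lam0 * kap u) = y ^+ 2 * (y * (y * lam0) * kap u) by ring.
    by rewrite ler_wpM2l ?sqr_ge0// ler_wpM2r ?(ltW kap0)// ler_wpM2l// ltW.
  apply: (@le_lt_trans _ _ ((1 + 8 * a) * (1 + 4 * w ^+ 2))).
    apply: ler_pM => //.
    - by rewrite exprn_ge0// ltW.
    - by rewrite mulr_ge0 ?(ltW kap0)// divr_ge0 ?(ltW dd0)// addr_ge0 ?(ltW u0)// mulr_ge0 ?(ltW v0)//; lra.
    - by move: y4; lra.
  have w2 : 4 * w ^+ 2 = w / A / 2.
    rewrite /w; field; rewrite gt_eqF//.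
  have a8 : 8 * a = w / A / 4 by rewrite /a; field; rewrite gt_eqF.
  rewrite w2 a8; have : w / A <= 1 by rewrite ler_pdivrMr// mul1r; lra.
  move: wA0; move: (w / A) => b b0 b1; nra.
Qed.

(** * Irregular vertices are rarely visited *)

Section IrregularRare.
Variables (R : realType) (G : multigraph) (d : nat).
Hypotheses (Gd : regular G d) (d3 : (3 <= d)%N) (Gconn : graph_connected G).
Variable o : vertex G.
Hypothesis return_le : forall s : R, 2 * Num.sqrt (d%:R - 1) < s ->
  forall m, walk_sum m (dirac_fun R o) o <= s ^+ m.

Let D := dist R Gd Gconn o.

Let D_endpoint s : is_walk o s -> (D (endpoint o s) <= size s)%N.
Proof.
elim/last_ind: s => [|s e IH]; first by rewrite /endpoint /= /D dist0.
rewrite -cats1 is_walk_cat endpoint_cat /= andbT => /andP[/IH + /eqP te].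
rewrite size_cat addn1 -te => h; rewrite {1}/endpoint /=.
by apply: leq_trans (dist_head R Gd Gconn o e) _; rewrite ltnS.
Qed.

(** Let [P j] be the probability that there are at least [n / m] visits to
irregular vertices and that the walk ends at distance [j]. It is bounded in two
ways: by the probability of ending at distance [j], which has the factor
[u ^+ j], and by the exponential moment, which has the factor [u ^- j]. In the
product these cancel, and the choice of parameters makes it exponentially small
uniformly in [j <= n]. The geometric mean of the two bounds thus takes the place of
locating the typical distance. *)
Lemma irregular_rare (m : nat) : (0 < m)%N -> exists C b : R,
  [/\ 0 <= C, 0 <= b < 1 & forall n,
  walk_mean d n o (fun s => (n <= m * irregular_count D s)%N%:R) <= C * b ^+ n].
Proof.
move=> m0; pose q : R := d%:R - 1; pose p := Num.sqrt q.
have q2 : 2 <= q.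
  have h : (3%:R : R) <= d%:R by rewrite ler_nat.
  by rewrite /q; lra.
have q0 : 0 < q by lra.
have p0 : 0 < p by rewrite sqrtr_gt0.
have pq : p ^+ 2 = q by rewrite sqr_sqrtr// ltW.
have dE : q + 1 = d%:R by rewrite subrK.
have d0 : 0 < d%:R :> R by rewrite -dE; lra.
have := tilting_parameters q2 pq p0 m0; rewrite dE /=.
move=> [u [y [r [r0 [[u1 /andP[y1 yu] r1 r01] [r0r rk ylam]]]]]].
set lam := (q * (y / u) + u / y) / d%:R in ylam.
pose kap := (q * u + u^-1) / d%:R; rewrite -/kap in ylam rk.
have u0 : 0 < u by case/andP: u1 => u1 _; apply: lt_trans u1.
have y0 : 0 < y by apply: lt_trans y1.
have r00 : 0 < r0 by apply: lt_le_trans r01.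
have p_y : 2 * p < p * (y + y^-1).
  rewrite mulrC ltr_pM2l// -subr_gt0.
  have -> : y + y^-1 - 2 = (y - 1) ^+ 2 / y by field; rewrite gt_eqF.
  by rewrite divr_gt0// exprn_gt0// subr_gt0.
pose s := (2 * p + p * (y + y^-1)) / 2.
have s1 : 2 * p < s by rewrite /s; lra.
have s2 : s < p * (y + y^-1) by rewrite /s; lra.
have s0 : 0 <= s by lra.
have y1u : 1 < y <= u by rewrite y1.
have [C C0 sphC] := sphere_walk_le Gd d3 Gconn p0 pq s0 (return_le s1) u1 y1u s2.
have u1' : 1 < u by case/andP: u1.
have [K K0 sphK] := spherical_lower d3 u1'.
pose beta := y * lam * kap / r0.
have lam0 : 0 <= lam.
  by rewrite divr_ge0 ?(ltW d0)// addr_ge0 ?mulr_ge0 ?invr_ge0 ?(ltW q0) ?(ltW y0) ?(ltW u0).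
have kap0 : 0 <= kap.
  by rewrite divr_ge0 ?(ltW d0)// addr_ge0 ?mulr_ge0 ?invr_ge0 ?(ltW q0) ?(ltW u0).
have beta0 : 0 <= beta by rewrite (divr_ge0 (mulr_ge0 (mulr_ge0 (ltW y0) lam0) kap0) (ltW r00)).
pose b := Num.sqrt beta.
have b0 : 0 <= b by apply: sqrtr_ge0.
have yb1 : y * b < 1.
  rewrite -(@ltr_pXn2r _ 2)// ?nnegrE ?mulr_ge0 ?(ltW y0)//.
  rewrite expr1n exprMn sqr_sqrtr// /beta !mulrA ltr_pdivrMr// mul1r.
  by move: ylam; rewrite !mulrA.
exists (Num.sqrt (C * K) * (1 + (y - 1)^-1)), (y * b); split.
- by rewrite mulr_ge0 ?sqrtr_ge0// addr_ge0// invr_ge0 subr_ge0 ltW.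
- by rewrite yb1 mulr_ge0 ?(ltW y0).
move=> n.
pose I s := (n <= m * irregular_count D s)%N.
pose P j := walk_mean d n o (fun s => (I s && (D (endpoint o s) == j))%:R : R).
have P0 j : 0 <= P j by apply: walk_mean_ge0.
have P1 j : P j <= C * (u * y) ^+ j * lam ^+ n.
  apply: (@le_trans _ _ (walk_mean d n o (fun s => (D (endpoint o s) == j)%:R))).
    by apply: le_walk_mean => w _ _; rewrite ler_nat; case: (I w).
  rewrite (walk_mean_endpoint d n o (fun x => (D x == j)%:R)) ler_pdivrMr ?exprn_gt0//.
  by rewrite -[leRHS]mulrA -exprMn divfK ?gt_eqF//; exact: sphC.
have P2 j : P j <= K / u ^+ j / r0 ^+ n * kap ^+ n.
  apply: (@le_trans _ _ (walk_mean d n o (fun s => (K / u ^+ j / r0 ^+ n) *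
     (r ^+ irregular_count D s * spherical d u (D (endpoint o s)))))).
    apply: le_walk_mean => w _ _.
    have sph_gt0 i : 0 < spherical d u i by case: (spherical_growth d3 u1' i).
    have rI0 : 0 <= r ^+ irregular_count D w by rewrite exprn_ge0// (le_trans _ r1).
    have c0 : 0 <= K / u ^+ j / r0 ^+ n.
      by rewrite !divr_ge0 ?exprn_ge0 ?(ltW u0) ?(ltW r00).
    have rhs0 : 0 <= K / u ^+ j / r0 ^+ n *
        (r ^+ irregular_count D w * spherical d u (D (endpoint o w))).
      by apply: mulr_ge0 => //; apply: mulr_ge0 => //; apply: ltW.
    case: (boolP (I w)) => [Iw|_] //; case: eqP => [Dj|_] //.
    have rn : r0 ^+ n <= r ^+ irregular_count D w.
      apply: (@le_trans _ _ (r0 ^+ (m * irregular_count D w))).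
        by rewrite ler_weXn2l.
      rewrite exprM; case: (irregular_count D w) => // i.
      by rewrite lerXn2r// nnegrE ?exprn_ge0 ?(ltW r00)// (le_trans _ r1).
    have h1 : 1 <= K / u ^+ j * spherical d u (D (endpoint o w)).
      by rewrite Dj mulrAC ler_pdivlMr ?exprn_gt0// mul1r; apply: sphK.
    have h2 : 1 <= (r0 ^+ n)^-1 * r ^+ irregular_count D w.
      by rewrite mulrC ler_pdivlMr ?exprn_gt0// mul1r.
    rewrite (_ : _ * (_ * _) = (K / u ^+ j * spherical d u (D (endpoint o w))) *
       ((r0 ^+ n)^-1 * r ^+ irregular_count D w)); last by ring.
    by rewrite /= mulr_ege1.
  rewrite walk_meanZ ler_wpM2l//.
    by rewrite !divr_ge0 ?exprn_ge0 ?(ltW u0) ?(ltW r00).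
  have Dh e : (D (head e) <= (D (tail e)).+1)%N by apply: dist_head.
  have Dp x : (0 < D x)%N -> exists2 e, tail e = x & (D (head e) < D x)%N.
    exact: dist_parent.
  apply: le_trans (exponential_moment Gd d3 Dh Dp u1' n o r1 rk) _.
  by rewrite /D dist0 mulr1.
have Pj j : (j <= n)%N -> P j <= Num.sqrt (C * K) * b ^+ n.
  move=> jn; rewrite -(@ler_pXn2r _ 2)// ?nnegrE ?mulr_ge0 ?sqrtr_ge0 ?exprn_ge0//.
  rewrite exprMn sqr_sqrtr ?mulr_ge0// exprAC sqr_sqrtr//.
  apply: (@le_trans _ _ (C * (u * y) ^+ j * lam ^+ n * (K / u ^+ j / r0 ^+ n * kap ^+ n))).
    by rewrite expr2 ler_pM.
  have -> : C * (u * y) ^+ j * lam ^+ n * (K / u ^+ j / r0 ^+ n * kap ^+ n) =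
     C * K * (y ^+ j * (lam ^+ n * kap ^+ n / r0 ^+ n)).
    by rewrite exprMn; field; rewrite !expf_neq0// gt_eqF.
  rewrite ler_wpM2l ?mulr_ge0// /beta.
  move: (lam) (kap) lam0 kap0 => l k l0 k0; rewrite !exprMn exprVn -!mulrA.
  by rewrite ler_wpM2r ?mulr_ge0 ?exprn_ge0 ?invr_ge0 ?exprn_ge0 ?(ltW r00)// ler_weXn2l// ltW.
apply: (@le_trans _ _ (walk_mean d n o (fun s => \sum_(j < n.+1)
    (I s && (D (endpoint o s) == j))%:R))).
  apply: le_walk_mean => w wn ww.
  have Dn : (D (endpoint o w) < n.+1)%N by rewrite ltnS -wn D_endpoint.
  rewrite (bigD1 (Ordinal Dn))//= eqxx andbT lerDl; exact: sumr_ge0.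
rewrite (walk_mean_sum d n o n.+1 (fun j s => (I s && (D (endpoint o s) == j))%:R)).
apply: (@le_trans _ _ (\sum_(j < n.+1) Num.sqrt (C * K) * b ^+ n)).
  by apply: ler_sum => j _; apply: Pj; rewrite -ltnS.
rewrite sumr_const card_ord -mulr_natl exprMn.
rewrite -[leRHS]mulrA mulrCA ler_wpM2l ?sqrtr_ge0// mulrA ler_wpM2r ?exprn_ge0//.
exact: linear_le_pow.
Qed.
End IrregularRare.

(** * Packing by disjoint blocks *)

Section Packing.
Variables (T : Type) (P : pred (seq T)).
Hypothesis P_nonempty : forall c, P c -> (0 < size c)%N.
Implicit Types (s c : seq T) (k m : nat).

Inductive packing : seq T -> nat -> Prop :=
| packing_nil : packing [::] 0
| packing_skip a s m : packing s m -> packing (a :: s) m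
| packing_block c s m : P c -> packing s m -> packing (c ++ s) (size c + m).

Lemma packing0 s : packing s 0.
Proof. by elim: s => [|a s IH]; [exact: packing_nil|exact: packing_skip]. Qed.

Lemma packing_cat s1 m1 s2 m2 :
  packing s1 m1 -> packing s2 m2 -> packing (s1 ++ s2) (m1 + m2).
Proof.
move=> pk1 pk2; elim: pk1 => [|a s m _ IH|c s m Pc _ IH] //=.
  exact: packing_skip.
by rewrite -catA -addnA; apply: packing_block.
Qed.

Definition covered s k := exists s1 c s2,
  [/\ s = s1 ++ c ++ s2, P c & (size s1 <= k < size s1 + size c)%N].

Definition coverage s := count (fun k => `[<covered s k>]) (iota 0 (size s)).

Lemma count_last_le n j : (count (fun k => (n - j <= k)%N) (iota 0 n) <= j)%N.
Proof.
rewrite -{2}(subnKC (leq_subr j n)) iotaD count_cat add0n.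
rewrite (_ : count _ (iota 0 (n - j)) = 0%N) ?add0n.
  by apply: leq_trans (count_size _ _) _; rewrite size_iota; lia.
apply/eqP; rewrite -leqn0 leqNgt -has_count; apply/hasPn => k.
by rewrite mem_iota add0n => /andP[_]; rewrite -ltnNge.
Qed.

Lemma count_first_le n j : (count (fun k => (k < j)%N) (iota 0 n) <= j)%N.
Proof.
have [jn|nj] := leqP n j.
  by apply: leq_trans (count_size _ _) _; rewrite size_iota.
rewrite -(subnKC (ltnW nj)) iotaD count_cat add0n.
rewrite [X in (_ + X)%N](_ : _ = 0%N) ?addn0.
  by apply: leq_trans (count_size _ _) _; rewrite size_iota.
apply/eqP; rewrite -leqn0 leqNgt -has_count; apply/hasPn => k.
by rewrite mem_iota => /andP[ck _]; rewrite -leqNgt.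
Qed.

(** A block that meets a longest block [c] stays within distance [size c] of
it, so it covers nothing beyond what [s1], [s2] cover by themselves and an
interval of length [3 * size c]. *)
Lemma coverage_cat s1 c s2 :
  (forall t1 c' t2, s1 ++ c ++ s2 = t1 ++ c' ++ t2 -> P c' -> (size c' <= size c)%N) ->
  (coverage (s1 ++ c ++ s2) <= coverage s1 + 3 * size c + coverage s2)%N.
Proof.
move=> cmax; rewrite /coverage !size_cat !iotaD !count_cat !add0n.
have h1 : (count (fun k => `[<covered (s1 ++ c ++ s2) k>]) (iota 0 (size s1)) <=
    coverage s1 + size c)%N.
  apply: leq_trans (leq_add (leqnn _) (count_last_le (size s1) (size c))).
  rewrite /coverage -count_predUI; apply: leq_trans (leq_addr _ _).
  rewrite -!size_filter; apply: uniq_leq_size; first by rewrite filter_uniq ?iota_uniq.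
  move=> k; rewrite !mem_filter => /andP[/asboolP [t1 [c' [t2 [E Pc kt]]]] ks].
  rewrite ks andbT /=; move: ks; rewrite mem_iota => ks.
  have cc := cmax _ _ _ E Pc.
  have [le|gt] := leqP (size t1 + size c') (size s1); last first.
    by apply/orP; right; move: kt ks cc gt; lia.
  apply/orP; left; apply/asboolP.
  exists t1, c', (take (size s1 - size t1 - size c') t2); split => //.
  have lt1 : (size t1 <= size s1)%N by move: le; clear; lia.
  have lt2 : (size c' <= size s1 - size t1)%N by move: le; clear; lia.
  rewrite -[LHS](take_size_cat (c ++ s2) erefl) E.
  by rewrite take_cat ltnNge lt1 /= take_cat ltnNge lt2.
have h3 : (count (fun k => `[<covered (s1 ++ c ++ s2) k>])
    (iota (size s1 + size c) (size s2)) <= coverage s2 + size c)%N.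
  apply: leq_trans (leq_add (leqnn _) (count_first_le (size s2) (size c))).
  rewrite -[(size s1 + size c)%N]addn0 iotaDl count_map.
  rewrite /coverage -count_predUI; apply: leq_trans (leq_addr _ _).
  rewrite -!size_filter; apply: uniq_leq_size; first by rewrite filter_uniq ?iota_uniq.
  move=> k; rewrite !mem_filter => /andP[/asboolP [t1 [c' [t2 [E Pc kt]]]] ks].
  rewrite ks andbT /=; have cc := cmax _ _ _ E Pc.
  have [le|gt] := leqP (size s1 + size c) (size t1); last first.
    by apply/orP; right; move: kt cc gt; lia.
  apply/orP; left; apply/asboolP.
  exists (drop (size s1 + size c) t1), c', t2; split => //; last first.
    by rewrite size_drop; move: kt le; lia.
  have E2 : s2 = drop (size s1 + size c) (s1 ++ c ++ s2).
    by rewrite catA drop_size_cat// size_cat.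
  rewrite [LHS]E2 E drop_cat.
  have [lt|ge] := ltnP; first by [].
  have -> : (size s1 + size c = size t1)%N by apply/eqP; rewrite eqn_leq le ge.
  by rewrite subnn drop0 drop_size.
have h2 : (count (fun k => `[<covered (s1 ++ c ++ s2) k>]) (iota (size s1) (size c)) <=
    size c)%N by rewrite -{2}(size_iota (size s1) (size c)) count_size.
by move: h1 h2 h3; rewrite /coverage; lia.
Qed.

(** The Vitali covering argument: remove a longest block and recurse on both
sides. *)
Lemma vitali_packing s : exists2 m, packing s m & (coverage s <= 3 * m)%N.
Proof.
have [n] := ubnP (size s); elim: n s => // n IH s sz.
pose Q l := `[<exists s1 c s2, [/\ s = s1 ++ c ++ s2, P c & size c = l]>].
have [exQ|nQ] := pselect (exists l, Q l); last first.
  exists 0%N; first exact: packing0.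
  rewrite leqNgt -has_count; apply/hasP => -[k _ /asboolP[s1 [c [s2 [E Pc _]]]]].
  by apply: nQ; exists (size c); apply/asboolP; exists s1, c, s2.
have Q_le l : Q l -> (l <= size s)%N.
  by move=> /asboolP[s1 [c [s2 [-> _ <-]]]]; rewrite !size_cat; lia.
case: (ex_maxnP exQ Q_le) => l /asboolP[s1 [c [s2 [E Pc cl]]]] lmax.
have c0 := P_nonempty Pc.
have [|m1 pk1 cov1] := IH s1; first by rewrite E !size_cat in sz; lia.
have [|m2 pk2 cov2] := IH s2; first by rewrite E !size_cat in sz; lia.
exists (m1 + (size c + m2))%N.
  by rewrite E; apply: packing_cat => //; apply: packing_block.
rewrite E; apply: leq_trans (coverage_cat _) _; last by move: cov1 cov2; lia.
move=> t1 c' t2 E' Pc'; rewrite cl; apply: lmax; apply/asboolP.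
by exists t1, c', t2; rewrite E E'.
Qed.

End Packing.

(** * Return probabilities *)

Section ReturnProbability.
Variables (R : realType) (G : multigraph) (d : nat).
Hypotheses (Gd : regular G d) (d3 : (3 <= d)%N) (Gconn : graph_connected G).
Let d_gt0 : 0 < d%:R :> R. Proof. by rewrite ltr0n; lia. Qed.

Lemma walk_sumZ m (a : R) (f : vertex G -> R) x :
  walk_sum m (fun x => a * f x) x = a * walk_sum m f x.
Proof.
elim: m x => //= m IH x; rewrite /nbr_sum mulr_sumr.
by apply: eq_bigr => e _; apply: IH.
Qed.

Lemma walk_sum_supermul m n (x y z : vertex G) : walk_sum m (dirac_fun R y) x *
  walk_sum n (dirac_fun R z) y <= walk_sum (m + n) (dirac_fun R z) x.
Proof.
rewrite walk_sum_add mulrC -walk_sumZ; apply: le_walk_sum => w.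
rewrite /dirac_fun; case: eqP => [->|_]; first by rewrite mulr1.
by rewrite mulr0; apply: walk_sum_ge0 => v; apply: ler0n.
Qed.

Lemma walk_sum_power n k (x : vertex G) : walk_sum n (dirac_fun R x) x ^+ k <=
  walk_sum (n * k) (dirac_fun R x) x.
Proof.
elim: k => [|k IH]; first by rewrite muln0 /= /dirac_fun eqxx.
rewrite exprS mulnS; apply: le_trans (walk_sum_supermul n (n * k) x x x).
by rewrite ler_wpM2l// walk_sum_ge0// => v; apply: ler0n.
Qed.

Lemma walk_sum_reach (x y : vertex G) : exists m, 0 < walk_sum m (dirac_fun R y) x.
Proof.
have dy0 v : 0 <= dirac_fun R y v by apply: ler0n.
have [j nz] := nb_dirac_reach R Gd Gconn y x; exists j.
have le : nb_sum j (dirac_fun R y) x <= walk_sum j (dirac_fun R y) x.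
  exact: (nb_le_walk_sum Gd d3).
by apply: lt_le_trans le; rewrite lt_neqAle eq_sym nz nb_sum_ge0.
Qed.

Lemma trans_probE n (x y : vertex G) :
  trans_prob R n x y = walk_sum n (dirac_fun R y) x / d%:R ^+ n.
Proof.
elim: n x => [|n IH] x /=; first by rewrite expr0 divr1 /dirac_fun.
rewrite /nbr_sum mulr_suml; apply: eq_out => e xe.
by rewrite /step_prob xe eqxx Gd IH exprS invfM mulrCA mulrA.
Qed.

Lemma limn_esup_lt_eventually (u : nat -> \bar R) (a : \bar R) :
  (limn_esup u < a)%E -> exists N, forall n, (N <= n)%N -> (u n < a)%E.
Proof.
move=> /ereal_inf_lt[_ [V [N _ NV] <-] ha]; exists N => n Nn.
by apply: le_lt_trans ha; apply: ereal_sup_ubound; exists n => //; apply: NV.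
Qed.

(** Closed walks at [o] can be repeated and, by connectedness, inserted in
closed walks at [x0]. So a single excess of the closed walk count at [o] would
be amplified to an excess of the growth rate at [x0]. *)
Lemma walk_sum_return_le (x0 : vertex G) (r : R) (o : vertex G) n :
  (spectral_radius R x0 < r%:E)%E ->
  walk_sum n (dirac_fun R o) o <= (d%:R * r) ^+ n.
Proof.
move=> /limn_esup_lt_eventually[N rN].
have p0 m x y : 0 <= walk_sum m (dirac_fun R y) x.
  by apply: walk_sum_ge0 => v; apply: ler0n.
have r0 : 0 <= r.
  by have := rN N (leqnn N); rewrite lte_fin => /ltW; apply: le_trans; apply: powR_ge0.
have bound m : (N <= m)%N -> (0 < m)%N ->
    walk_sum m (dirac_fun R x0) x0 <= (d%:R * r) ^+ m.
  move=> /rN; rewrite lte_fin trans_probE => h m0.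
  have w0 : 0 <= walk_sum m (dirac_fun R x0) x0 / d%:R ^+ m.
    by rewrite divr_ge0// exprn_ge0// ltW.
  rewrite exprMn mulrC -ler_pdivrMr ?exprn_gt0//.
  have -> : walk_sum m (dirac_fun R x0) x0 / d%:R ^+ m =
      ((walk_sum m (dirac_fun R x0) x0 / d%:R ^+ m) `^ m%:R^-1) ^+ m.
    by rewrite -powR_mulrn ?powR_ge0// -powRrM mulVf ?pnatr_eq0 -?lt0n// powRr1.
  by rewrite lerXn2r ?nnegrE ?powR_ge0// ltW.
case: n => [|n]; first by rewrite expr0 /= /dirac_fun eqxx.
have [a a0] := walk_sum_reach x0 o; have [b b0] := walk_sum_reach o x0.
set A := walk_sum a _ _ in a0; set B := walk_sum b _ _ in b0.
set W := walk_sum n.+1 _ _; set S := d%:R * r.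
have S0 : 0 <= S by rewrite mulr_ge0// ltW.
rewrite leNgt; apply/negP => WS.
have W0 : 0 < W by apply: le_lt_trans WS; rewrite exprn_ge0.
have t01 : 0 <= S ^+ n.+1 / W < 1.
  by rewrite ltr_pdivrMr// mul1r WS divr_ge0 ?exprn_ge0// ltW.
have key k : A * B <= 0 + (S ^+ (a + b) * (S ^+ n.+1 / W) ^+ N.+1) * (S ^+ n.+1 / W) ^+ k.
  rewrite add0r -mulrA -exprD expr_div_n mulrA ler_pdivlMr ?exprn_gt0//.
  rewrite -exprM -exprD.
  have -> : (a + b + n.+1 * (N.+1 + k) = a + (n.+1 * (N.+1 + k) + b))%N by lia.
  apply: le_trans (bound _ _ _); [|nia|nia].
  apply: le_trans (walk_sum_supermul _ _ _ o _).
  rewrite -mulrA ler_wpM2l ?(ltW a0)// mulrC.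
  apply: le_trans (walk_sum_supermul _ _ _ o _).
  by rewrite ler_wpM2r ?(ltW b0)// walk_sum_power.
have := ler_geometric_error t01 key.
by rewrite leNgt mulr_gt0.
Qed.

End ReturnProbability.

(** * Long cycles are rare *)

Section LongCycles.
Variables (R : realType) (G : multigraph) (d : nat).
Hypotheses (Gd : regular G d) (d3 : (3 <= d)%N).
Variable rho : R.
Hypotheses (rho_gt0 : 0 < rho) (rho_lt1 : rho < 1).
Hypothesis return_le : forall (x : vertex G) n,
  walk_sum n (dirac_fun R x) x <= (d%:R * rho) ^+ n.

Let d_gt0 : (0 < d)%N. Proof. by lia. Qed.

Lemma walk_mean_cycle_le n x : (0 < n)%N ->
  walk_mean d n x (fun s => (cycle (@adj G) s)%:R) <= rho ^+ n.
Proof.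
move=> n0; apply: (@le_trans _ _ (walk_mean d n x (fun s => dirac_fun R x (endpoint x s)))).
  apply: le_walk_mean => -[|e s] sn ws; first by rewrite -sn in n0.
  rewrite cycle_adjE /dirac_fun; have /eqP -> : tail e == x by case/andP: ws.
  by rewrite ws.
rewrite walk_mean_endpoint ler_pdivrMr ?exprn_gt0 ?ltr0n//.
by rewrite mulrC -exprMn.
Qed.

Lemma walk_mean_final_cycle_le i n x : (i < n)%N ->
  walk_mean d n x (fun s => (cycle (@adj G) (drop i s))%:R) <= rho ^+ (n - i).
Proof.
move=> lt_in; rewrite -{1}(subnKC (ltnW lt_in)) walk_mean_cat.
rewrite -[leRHS](walk_mean_cst Gd d_gt0 i x); apply: le_walk_mean => s si _.
under eq_fun do rewrite drop_size_cat//.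
by apply: walk_mean_cycle_le; rewrite subn_gt0.
Qed.

Definition long_cycle L c := (L < size c)%N && cycle (@adj G) c.

Lemma long_cycle_nonempty L c : long_cycle L c -> (0 < size c)%N.
Proof. by move=> /andP[+ _]; apply: leq_trans. Qed.

Definition packed L M s := `[< exists2 m, (M <= m)%N & packing (long_cycle L) s m >].

(** Union bound over the first block of a packing: either the first edge is left
uncovered or a block of some length [l] starts there. *)
Lemma packed_cons L M e s : (packed L M (e :: s))%:R <= (packed L M s)%:R +
  \sum_(l < (size s).+2) (long_cycle L (take l (e :: s)) &&
    packed L (M - l) (drop l (e :: s)))%:R :> R.
Proof.
case: (boolP (packed L M (e :: s))) => [/asboolP[m Mm pk]|_]; last first.
  by rewrite addr_ge0// sumr_ge0.
inversion pk as [|a s' m' pk' E1 E2|c s' m' Pc pk' E1 E2].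
  by rewrite (_ : packed L M s) ?lerDl ?sumr_ge0//; apply/asboolP; exists m.
have cs : (size c < (size s).+2)%N.
  by rewrite ltnS -[(size s).+1]/(size (e :: s)) -E1 size_cat leq_addr.
rewrite (bigD1 (Ordinal cs))//= take_size_cat// drop_size_cat// Pc /=.
rewrite (_ : packed L (M - size c) s').
  by rewrite addrCA lerDl addr_ge0// sumr_ge0.
by apply/asboolP; exists m' => //; rewrite leq_subLR -E2 in Mm *.
Qed.

(** A block of length [l] closes up with probability at most [rho ^+ l],
whatever happened before, so it costs more than the factor [y ^+ l] that it
saves in the bound; [eta] bounds the total weight of the block lengths. *)
Lemma packed_mean_le L (y eta : R) : 1 <= y -> 0 <= eta ->
  (forall k, \sum_(l < k) (L < l)%:R * (rho * y) ^+ l <= eta) ->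
  forall n M x, walk_mean d n x (fun s => (packed L M s)%:R) <= (1 + eta) ^+ n / y ^+ M.
Proof.
move=> y1 eta0 etaP; have y0 : 0 < y by apply: lt_le_trans y1.
have e1 : 1 <= 1 + eta by rewrite lerDl.
have e0 : 0 <= 1 + eta by apply: le_trans e1.
elim/ltn_ind => -[_|n IH] M x.
  rewrite /walk_mean expr0 mul1r; case: (boolP (packed L M [::])) => [/asboolP[m Mm pk]|_].
    suff m0 : m = 0%N by move: Mm; rewrite m0 leqn0 => /eqP->; rewrite expr0 invr1.
    inversion pk as [| |c s' m' Pc pk' E1 E2] => //.
    by case: c Pc E1 {E2 pk} => // /long_cycle_nonempty.
  by rewrite invr_ge0 exprn_ge0// ltW.
have yM0 k : 0 < y ^+ k by rewrite exprn_gt0.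
set B := (1 + eta) ^+ n / y ^+ M.
have B0 : 0 <= B by rewrite divr_ge0 ?exprn_ge0// ltW.
apply: (@le_trans _ _ (walk_mean d n.+1 x (fun s => (packed L M (behead s))%:R +
   \sum_(l < n.+2) (long_cycle L (take l s) && packed L (M - l) (drop l s))%:R))).
  by apply: le_walk_mean => -[//|e s] [<-] _; apply: packed_cons.
rewrite walk_meanD.
rewrite (walk_mean_sum d n.+1 x n.+2
  (fun l s => (long_cycle L (take l s) && packed L (M - l) (drop l s))%:R)).
have first_le : walk_mean d n.+1 x (fun s => (packed L M (behead s))%:R) <= B.
  rewrite -[leRHS](walk_mean_cst Gd d_gt0 1 x) !walk_meanS ler_wpM2l ?invr_ge0//.
  by apply: ler_sum => e _; apply: IH.
apply: le_trans (lerD first_le (_ : _ <= \sum_(l < n.+2) (L < l)%:R * (rho * y) ^+ l * B)) _.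
  apply: ler_sum => -[l ln] _ /=; rewrite ltnS in ln.
  have [Ll|lL] := ltnP L l; last first.
    rewrite mul0r mul0r -[leRHS](walk_mean0 R d n.+1 x). apply: le_walk_mean => s sn _.
    by rewrite /long_cycle ltnNge (leq_trans _ lL)// size_take_min geq_minl.
  have l0 : (0 < l)%N by apply: leq_ltn_trans Ll.
  rewrite -[in leLHS](subnKC ln) walk_mean_cat mul1r.
  apply: (@le_trans _ _ (walk_mean d l x (fun s => (1 + eta) ^+ (n.+1 - l) / y ^+ (M - l) *
     (cycle (@adj G) s)%:R))).
    apply: le_walk_mean => s sl _.
    under eq_fun do rewrite take_size_cat// drop_size_cat//.
    rewrite /long_cycle sl Ll /=; case: (cycle _ s) => /=; last first.
      by rewrite walk_mean0 mulr0.
    by rewrite mulr1; apply: IH; rewrite ltn_subrL l0.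
  rewrite walk_meanZ.
  have c0 : 0 <= (1 + eta) ^+ (n.+1 - l) / y ^+ (M - l).
    by rewrite divr_ge0 ?exprn_ge0// ltW.
  apply: le_trans (ler_wpM2l c0 (walk_mean_cycle_le x l0)) _.
  rewrite exprMn [leRHS](_ : _ = (1 + eta) ^+ n * (y ^+ l / y ^+ M) * rho ^+ l).
    rewrite ler_wpM2r ?exprn_ge0 ?(ltW rho_gt0)//.
    apply: ler_pM; rewrite ?exprn_ge0 ?invr_ge0 ?exprn_ge0 ?(ltW y0)//.
      by rewrite ler_weXn2l//; move: l0; clear; lia.
    rewrite ler_pdivlMr// mulrC ler_pdivrMr// -exprD ler_weXn2l//.
    by clear; lia.
  by rewrite /B; field; rewrite gt_eqF.
rewrite -mulr_suml -{1}[B]mul1r -mulrDl.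
have -> : (1 + eta) ^+ n.+1 / y ^+ M = (1 + eta) * B by rewrite exprS mulrA.
by rewrite ler_wpM2r// lerD2l.
Qed.

Lemma geometric_tail_le (t : R) L k : 0 <= t < 1 ->
  \sum_(l < k) (L < l)%:R * t ^+ l <= t ^+ L / (1 - t).
Proof.
move=> t01; have /andP[t0 t1] := t01; have t1' : 0 < 1 - t by rewrite subr_gt0.
have [kL|Lk] := leqP k L.
  rewrite big1 ?divr_ge0 ?exprn_ge0// ?ltW// => i _.
  by rewrite ltnNge (leq_trans (ltnW (ltn_ord i)) kL) mul0r.
rewrite -(subnKC (ltnW Lk)) big_split_ord /= big1 ?add0r => [|i _]; last first.
  by rewrite ltnNge (ltnW (ltn_ord i)) mul0r.
apply: le_trans (ler_wpM2l (exprn_ge0 L t0) (geometric_sum_le (k - L) t01)).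
rewrite mulr_sumr; apply: ler_sum => i _; rewrite -exprD.
by case: (L < _)%N; rewrite ?mul1r// mul0r exprn_ge0.
Qed.

(** Fix the factor [y] with [rho * y < 1]. For large [L] the weight [eta] is as
small as desired, and so the growth [1 + eta] per step loses against the gain
[y] per three covered positions. *)
Lemma long_coverage_rare (m : nat) (x : vertex G) : (0 < m)%N ->
  exists L (C b : R), [/\ 0 <= C, 0 <= b < 1 & forall n,
  walk_mean d n x (fun s => (n <= m * coverage (long_cycle L) s)%N%:R) <= C * b ^+ n].
Proof.
move=> m0; pose y := (1 + rho^-1) / 2; pose t := rho * y.
have rhoV : 1 < rho^-1 by rewrite invf_gt1.
have y1 : 1 < y by rewrite /y; lra.
have y0 : 0 < y by apply: lt_trans y1.
have tE : t = (rho + 1) / 2 by rewrite /t /y; field; rewrite gt_eqF.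
have t01 : 0 <= t < 1.
  rewrite tE; clearbody t; move: rho_gt0 rho_lt1 => r0 r1.
  apply/andP; split; lra.
pose k := (3 * m)%N.
have [z z1 zk] : exists2 z : R, 1 < z & z ^+ k <= y.
  have k1 : 1 <= k%:R :> R by rewrite ler1n /k muln_gt0.
  pose a := Num.min 1 (y - 1) / (2 * k%:R).
  have min0 : 0 < Num.min 1 (y - 1) by rewrite lt_min ltr01 subr_gt0.
  have a0 : 0 < a by rewrite divr_gt0//; lra.
  have ka : 2 * k%:R * a = Num.min 1 (y - 1).
    by rewrite /a; field; rewrite gt_eqF//; lra.
  exists (1 + a); first by rewrite ltrDl.
  apply: le_trans (bernoulli_le (ltW a0) _) _; first by rewrite ka ge_min lexx.
  by rewrite ka -lerBrDl ge_min lexx orbT.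
have z0 : 0 < z by apply: lt_trans z1.
have t1' : 0 < 1 - t by case/andP: t01; rewrite subr_gt0.
have z10 : 0 < (z - 1) * (1 - t) by rewrite mulr_gt0// subr_gt0.
have [L tL] := expr_lt_eventually t01 z10.
have t0 : 0 <= t by case/andP: t01.
pose eta := t ^+ L / (1 - t).
have eta0 : 0 <= eta by rewrite divr_ge0 ?exprn_ge0// ltW.
have etaz : 1 + eta < z by rewrite -ltrBrDl ltr_pdivrMr.
exists L, y, ((1 + eta) / z); split; first exact: ltW.
  by rewrite ltr_pdivrMr// mul1r etaz divr_ge0 ?(ltW z0)// addr_ge0.
move=> n; pose M := (n %/ k)%N.
have k0 : (0 < k)%N by rewrite /k muln_gt0.
apply: (@le_trans _ _ (walk_mean d n x (fun s => (packed L M s)%:R))).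
  apply: le_walk_mean => s _ _; rewrite ler_nat; case: (boolP (n <= _)%N) => // ncov.
  suff -> : packed L M s by []; apply/asboolP.
  have [m' pk cov] := vitali_packing (@long_cycle_nonempty L) s; exists m' => //.
  rewrite -(leq_pmul2r k0); apply: leq_trans (leq_trunc_div n k) (leq_trans ncov _).
  apply: leq_trans (leq_mul (leqnn m) cov) _.
  by rewrite /k mulnCA [(m' * _)%N]mulnCA [(m' * m)%N]mulnC.
have etaP j : \sum_(l < j) (L < l)%:R * (rho * y) ^+ l <= eta.
  exact: geometric_tail_le.
apply: le_trans (packed_mean_le (ltW y1) eta0 etaP n M x) _.
have -> : y * ((1 + eta) / z) ^+ n = (1 + eta) ^+ n * (y / z ^+ n).
  by rewrite expr_div_n mulrCA.
rewrite ler_wpM2l ?exprn_ge0 ?addr_ge0//.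
rewrite ler_pdivlMr ?exprn_gt0// mulrC ler_pdivrMr ?exprn_gt0// -exprS.
apply: (@le_trans _ _ (z ^+ (k * M.+1))).
  by rewrite ler_weXn2l ?(ltW z1)// ltnW// mulnC ltn_ceil.
by rewrite exprM lerXn2r ?nnegrE ?exprn_ge0 ?(ltW z0) ?(ltW y0).
Qed.

Definition final_long_cycle s :=
  has (fun i => (2 * i <= size s)%N && cycle (@adj G) (drop i s)) (iota 0 (size s)).

Lemma final_long_cycle_rare x : exists C b : R, [/\ 0 <= C, 0 <= b < 1 & forall n,
  walk_mean d n x (fun s => (final_long_cycle s)%:R) <= C * b ^+ n].
Proof.
pose s := Num.sqrt rho.
have s0 : 0 < s by rewrite sqrtr_gt0.
have s2 : s ^+ 2 = rho by rewrite sqr_sqrtr// ltW.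
have s1 : s < 1 by rewrite -(@ltr_pXn2r _ 2)// ?nnegrE ?(ltW s0)// s2 expr1n.
pose z := (1 + s^-1) / 2.
have sV : 1 < s^-1 by rewrite invf_gt1.
have z1 : 1 < z by rewrite /z; lra.
have zs : z * s = (s + 1) / 2 by rewrite /z; field; rewrite gt_eqF.
exists (1 + (z - 1)^-1), (z * s); split.
- by rewrite addr_ge0// invr_ge0 subr_ge0 ltW.
- by rewrite zs; apply/andP; split; lra.
move=> n; apply: (@le_trans _ _ (\sum_(i < n) s ^+ n)); last first.
  rewrite sumr_const card_ord -mulr_natl exprMn mulrA ler_wpM2r ?exprn_ge0 ?(ltW s0)//.
  by apply: le_trans (linear_le_pow n z1); rewrite ler_nat.
apply: (@le_trans _ _ (walk_mean d n x (fun w => \sum_(i < n)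
    ((2 * i <= n)%N && cycle (@adj G) (drop i w))%:R))).
  apply: le_walk_mean => w wn _; rewrite /final_long_cycle wn.
  case: hasP => [[i]|_]; last by rewrite sumr_ge0.
  rewrite mem_iota add0n => /= lt_in hi; rewrite (bigD1 (Ordinal lt_in))//= hi.
  by rewrite lerDl sumr_ge0.
rewrite (walk_mean_sum d n x n (fun i w => ((2 * i <= n)%N && cycle (@adj G) (drop i w))%:R)).
apply: ler_sum => -[i lt_in] _ /=; case: (leqP (2 * i) n) => [hi|_] /=; last first.
  by rewrite walk_mean0 exprn_ge0// ltW.
apply: le_trans (walk_mean_final_cycle_le x lt_in) _.
rewrite -s2 -exprM ler_wiXn2l ?(ltW s0) ?(ltW s1)//.
by move: hi; clear; lia.
Qed.

End LongCycles.

(** * From averages to almost sure statements *)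

Section CylinderMeasure.
Variables (R : realType) (G : multigraph) (d : nat).
Hypotheses (Gd : regular G d) (d_gt0 : (0 < d)%N).
Variables (disp : measure_display) (T : measurableType disp) (P : probability T R).
Variables (o : vertex G) (X : nat -> T -> edge G).
Hypothesis X_walk : simple_random_walk P o X.

Definition prefix n w := [seq X i w | i <- iota 1 n].

Let cylinder s := [set w | prefix (size s) w = s].

Lemma prefixS n w : prefix n.+1 w = rcons (prefix n w) (X n.+1 w).
Proof. by rewrite /prefix -{1}[n]addn0 -addnS iotaD map_cat cats1. Qed.

Let measurable_cylinder s : measurable (cylinder s).
Proof.
elim/last_ind: s => [|s e IH].
  by rewrite (_ : cylinder _ = setT)//; apply/seteqP; split.
rewrite (_ : cylinder _ = cylinder s `&` (X (size s).+1 @^-1` [set e])).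
  by apply: measurableI => //; case: X_walk => + _; apply.
apply/seteqP; split => w; rewrite /cylinder /= size_rcons prefixS.
  by move=> /rcons_inj[-> ->].
by move=> [-> ->].
Qed.

Let cylinder_prob s : is_walk o s -> P (cylinder s) = (d%:R^-1 ^+ size s)%:E.
Proof.
case: X_walk => _ markov.
elim/last_ind: s => [|s e IH].
  by move=> _; rewrite (_ : cylinder _ = setT) ?probability_setT//; apply/seteqP; split.
rewrite -cats1 is_walk_cat cats1 /= andbT => /andP[/IH IH' /eqP te].
rewrite /cylinder size_rcons [LHS](markov s e) -/(prefix _ _) IH'.
rewrite /step_prob te -/(endpoint o s) eqxx Gd -EFinM exprSr//.
Qed.

Variable Q : pred (seq (edge G)).

(** Only genuine walks are used, so all unions are finite; trajectories that do
not follow the graph are left out, and turn out to form a null set. *)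
Fixpoint event_inside n s : set T :=
  if n is m.+1 then \big[setU/set0]_(e <- out_edges (endpoint o s)) event_inside m (rcons s e)
  else if Q s then cylinder s else set0.

Lemma event_inside_measurable n s : measurable (event_inside n s).
Proof.
elim: n s => [|n IH] s /=; first by case: ifP.
by apply: bigsetU_measurable.
Qed.

Lemma event_inside_sub n s w : event_inside n s w ->
  prefix (size s) w = s /\ Q (prefix (size s + n) w).
Proof.
elim: n s => [|n IH] s /=.
  by case: ifP => // Qs; rewrite /cylinder /= addn0 => ->.
rewrite -bigcup_seq => -[e /= _ /IH]; rewrite size_rcons prefixS addSnnS.
by move=> [/rcons_inj[-> _] ?].
Qed.

Lemma event_inside_prob n s : is_walk o s ->
  P (event_inside n s) =
  (d%:R^-1 ^+ size s * walk_mean d n (endpoint o s) (fun t => (Q (s ++ t))%:R))%:E.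
Proof.
elim: n s => [|n IH] s ws /=.
  rewrite /walk_mean cats0; case: (Q s) => /=; first by rewrite cylinder_prob ?mulr1.
  by rewrite measure0 mulr0.
rewrite measure_fbigsetU => [|e _|]; last 2 first.
- exact: event_inside_measurable.
- apply/trivIsetP => e f _ _ ef; apply/seteqP; split => // w [/event_inside_sub[+ _]].
  move=> pe /event_inside_sub[pf _]; move: pe; rewrite size_rcons -(size_rcons s f) pf.
  by move=> /rcons_inj[/esym/eqP]; rewrite (negbTE ef).
rewrite walk_meanS mulrA -exprSr mulr_sumr -sumEFin big_seq [RHS]big_seq.
apply: eq_bigr => e; rewrite mem_out_edges => /eqP te.
rewrite /= IH; last by rewrite -cats1 is_walk_cat ws /= te eqxx.
rewrite size_rcons -cats1 endpoint_cat; congr (_ * _)%:E; congr walk_mean.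
by apply/funext => t; rewrite -catA.
Qed.

End CylinderMeasure.

Section AlmostSurely.
Variables (R : realType) (G : multigraph) (d : nat).
Hypotheses (Gd : regular G d) (d_gt0 : (0 < d)%N).
Variables (disp : measure_display) (T : measurableType disp) (P : probability T R).
Variables (o : vertex G) (X : nat -> T -> edge G).
Hypothesis X_walk : simple_random_walk P o X.

(** The complement of the set built from the negation of [Q]: it is measurable
and has the right probability because the finitely many walks of length [n]
carry the full mass. *)
Lemma prefix_event_cover n (Q : pred (seq (edge G))) :
  exists U : set T, [/\ measurable U, [set w | Q (prefix X n w)] `<=` U &
    P U = (walk_mean d n o (fun s => (Q s)%:R))%:E].
Proof.
exists (~` event_inside o X (predC Q) n [::]); split.
- by apply: measurableC; apply: event_inside_measurable X_walk _ _ _.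
- by move=> w /= Qw /event_inside_sub[_] /=; rewrite Qw.
rewrite probability_setC; last exact: event_inside_measurable X_walk _ _ _.
rewrite (event_inside_prob Gd X_walk)//= expr0 mul1r -EFinB; congr _%:E.
rewrite -{1}(walk_mean_cst Gd d_gt0 n o (1 : R)); apply/eqP; rewrite subr_eq.
rewrite -walk_meanD; apply/eqP; congr walk_mean; apply/funext => s /=.
by case: (Q s); rewrite ?addr0 ?add0r.
Qed.

Lemma prefix_eventually (Q : nat -> pred (seq (edge G))) (C b : R) :
  0 <= C -> 0 <= b < 1 ->
  (forall n, walk_mean d n o (fun s => (Q n s)%:R) <= C * b ^+ n) ->
  {ae P, forall w, exists N, forall n, (N <= n)%N -> ~~ Q n (prefix X n w)}.
Proof.
move=> C0 b01 QC.
have /choice[U UP] := fun n => prefix_event_cover n (Q n).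
have mU n : measurable (U n) by case: (UP n).
have U0 : P (lim_sup_set U) = 0.
  apply: lim_sup_set_cvg0 => //.
  apply: (@le_lt_trans _ _ (C * (1 - b)^-1)%:E); last exact: ltry.
  apply: lime_le; first by apply: is_cvg_nneseries.
  apply: nearW => n.
  apply: (@le_trans _ _ (\sum_(0 <= i < n) (C * b ^+ i)%:E)%E).
    by apply: lee_sum => i _ /=; case: (UP i) => _ _ UPi; rewrite UPi lee_fin.
  rewrite sumEFin lee_fin -mulr_sumr ler_wpM2l// big_mkord.
  exact: geometric_sum_le.
exists (lim_sup_set U); split => //.
  apply: bigcap_measurable => // k _; exact: bigcup_measurable.
move=> w /= nw n _; apply: contrapT => nU; apply: nw; exists n => k nk.
apply/negP => Qk; apply: nU; exists k => //.
by case: (UP k) => _ + _; apply.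
Qed.

End AlmostSurely.

Lemma count_near_le (p : pred nat) L s (r : seq nat) : uniq s ->
  (count (fun k => has (fun i => p i && (i <= k + L) && (k <= i + L))%N r) s <=
   2 * L.+1 * count p r)%N.
Proof.
move=> us; elim: r => [|i r IH] /=; first by rewrite (eq_count (a2 := pred0)) ?count_pred0.
rewrite mulnDr; apply: leq_trans (leq_add (_ : (count (fun k => p i && (i <= k + L) && (k <= i + L))%N s <= _)%N) IH).
  by rewrite -count_predUI; apply: leq_addr.
case: (p i) => /=; last by rewrite (eq_count (a2 := pred0)) ?count_pred0.
rewrite muln1 -size_filter -(size_iota (i - L) (2 * L.+1)).
apply: uniq_leq_size; first by rewrite filter_uniq.
by move=> k; rewrite mem_filter mem_iota; lia.
Qed.

(** * Counting cycle times *)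

Section Counting.
Variable G : multigraph.
Variable D : vertex G -> nat.
Hypothesis D_parent : forall x, (0 < D x)%N ->
  exists2 e, tail e = x & (D (head e) < D x)%N.
Variable x : nat -> edge G.
Implicit Types (n N L : nat).

Let pre n := [seq x i | i <- iota 1 n].

(** A short nontrivial cycle contains an irregular vertex, which is then close
to the time [k]. A long one lies within the first [2 * n] steps, where it is seen
by [covered], or else it reaches beyond time [2 * n] from a start not after
time [n], and then it is at least the second half of the trajectory up to its end. *)
Lemma cycle_time_cases L N n k : (L <= n)%N -> (N <= n)%N ->
  (forall b, (N <= b)%N -> ~~ final_long_cycle (pre b)) ->
  (1 <= k <= n)%N -> nontrivial_cycle_time x k ->
  has (fun i => irregular D (tail (x i)) && (i <= k + L) && (k <= i + L))%N (iota 1 (2 * n))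
  \/ covered (@long_cycle G L) (pre (2 * n)) k.-1.
Proof.
move=> Ln Nn noQ /andP[k1 kn] [a [b [/andP[a1 ak] [kb ntc]]]].
have ntc' := ntc; case: ntc => -[_ cyc] _; move: cyc ntc'.
rewrite /index_iota; set c := [seq x i | i <- _] => cyc ntc.
have sc : size c = (b.+1 - a)%N by rewrite size_map size_iota.
have [cL|Lc] := leqP (size c) L.
  left; have /hasP[e] := nontrivial_cycle_irregular D_parent ntc.
  move=> /mapP[i]; rewrite mem_iota => iab -> irr; apply/hasP; exists i.
    by rewrite mem_iota; lia.
  by rewrite irr /=; lia.
have iotaE m : (b <= m)%N -> iota 1 m = iota 1 a.-1 ++ iota a (b.+1 - a) ++ iota b.+1 (m - b).
  move=> bm; have -> : (m = a.-1 + ((b.+1 - a) + (m - b)))%N by lia.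
  rewrite !iotaD; congr (_ ++ (iota _ _ ++ iota _ _)); lia.
have lc : long_cycle L c by rewrite /long_cycle Lc cyc.
have [b2n|nb_sum] := leqP b (2 * n).
  right; exists [seq x i | i <- iota 1 a.-1], c, [seq x i | i <- iota b.+1 (2 * n - b)].
  split => //; first by rewrite /pre (iotaE _ b2n) !map_cat.
  by rewrite sc size_map size_iota; lia.
exfalso; have /negP := noQ b (leq_trans Nn (leq_trans (leq_pmull n (isT : 0 < 2)%N) (ltnW nb_sum))).
apply; apply/hasP; exists a.-1; first by rewrite mem_iota size_map size_iota; lia.
apply/andP; split; first by rewrite size_map size_iota; lia.
rewrite /pre (iotaE b (leqnn b)) !map_cat drop_size_cat ?size_map ?size_iota//.
by rewrite subnn cats0.
Qed.

Lemma cycle_time_count L N n : (L <= n)%N -> (N <= n)%N ->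
  (forall b, (N <= b)%N -> ~~ final_long_cycle (pre b)) ->
  (#|` fset_set [set k : nat | (1 <= k <= n)%N /\ nontrivial_cycle_time x k] |%fset
   <= 2 * L.+1 * irregular_count D (pre (2 * n)) +
      coverage (@long_cycle G L) (pre (2 * n)))%N.
Proof.
move=> Ln Nn noQ.
pose short k := has (fun i => irregular D (tail (x i)) && (i <= k + L) && (k <= i + L))%N
  (iota 1 (2 * n)).
pose long k := `[< covered (@long_cycle G L) (pre (2 * n)) k.-1 >].
have fin : finite_set [set k : nat | (1 <= k <= n)%N /\ nontrivial_cycle_time x k].
  apply: (@sub_finite_set _ _ `I_n.+1); last exact: finite_II.
  by move=> k /= [/andP[_ kn] _].
apply: (@leq_trans (count (predU short long) (iota 1 n))).
  rewrite -size_filter cardfE cardE.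
  rewrite -(size_map val); apply: uniq_leq_size.
    by rewrite map_inj_uniq ?enum_uniq//; apply: val_inj.
  move=> k /mapP[k' _ ->]; have := valP k'; rewrite /= in_fset_set// inE /= => -[kn ct].
  rewrite mem_filter mem_iota add1n ltnS kn andbT /=.
  have [s|l] := cycle_time_cases Ln Nn noQ kn ct; apply/orP; [left|right] => //.
  exact/asboolP.
apply: (@leq_trans (count short (iota 1 n) + count long (iota 1 n))).
  by rewrite -count_predUI leq_addr.
apply: leq_add.
  rewrite /irregular_count /pre count_map.
  exact: (count_near_le (fun i => irregular D (tail (x i)))) (iota_uniq _ _).
have -> : iota 1 n = map succn (iota 0 n).
  by rewrite -[1%N]addn0 iotaDl; apply: eq_map.
rewrite count_map /coverage size_map size_iota.
have -> : iota 0 (2 * n) = iota 0 n ++ iota (0 + n) n by rewrite mul2n -addnn iotaD.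
by rewrite count_cat; apply: leq_trans (leq_addr _ _).
Qed.

End Counting.

Lemma cvg0_of_density (R : realType) (u : nat -> nat) :
  (forall m : nat, exists N, forall n, (N <= n)%N -> (m * u n <= n)%N) ->
  (fun n : nat => (u n)%:R / n%:R : R) @ \oo --> (0 : R).
Proof.
move=> um; apply/cvgrPdist_le => e e0.
pose m := (Num.bound e^-1).
have [N Nu] := um m; exists (maxn N 1) => // n /=; rewrite geq_max => /andP[Nn n0].
rewrite sub0r normrN ger0_norm ?divr_ge0// ler_pdivrMr ?ltr0n//.
have me : e^-1 < m%:R by apply: archi_boundP; rewrite invr_ge0 ltW.
have h : m%:R * (u n)%:R <= n%:R :> R by rewrite -natrM ler_nat Nu.
rewrite -ler_pdivrMl//; apply: le_trans h; rewrite ler_wpM2r//; exact: ltW.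
Qed.

Lemma ramanujan_radius_lt1 (R : realType) (d : nat) : (3 <= d)%N ->
  2 * Num.sqrt (d%:R - 1) / d%:R < 1 :> R.
Proof.
move=> d3; have h : (3%:R : R) <= d%:R by rewrite ler_nat.
have q0 : 0 <= d%:R - 1 :> R by lra.
rewrite ltr_pdivrMr ?ltr0n ?(leq_trans _ d3)// mul1r.
have := sqr_sqrtr q0; have := sqrtr_ge0 (d%:R - 1 : R).
move: (Num.sqrt _) => s s0 s2; rewrite -subr_gt0.
have -> : d%:R - 2 * s = (s - 1) ^+ 2 by rewrite sqrrB1 s2; ring.
rewrite exprn_even_gt0//= subr_eq0; apply/eqP => s1.
by move: s2; rewrite s1 expr1n; lra.
Qed.

Theorem theorem1p1 (R : realType) (d : nat) (G : multigraph)
  (d_ge3 : (3 <= d)%N)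
  (G_infinite : infinite_set [set: vertex G])
  (G_connected : graph_connected G)
  (G_regular : regular G d)
  (x0 : vertex G)
  (G_ramanujan :
    spectral_radius R x0 = (2 * Num.sqrt (d%:R - 1) / d%:R)%:E)
  (disp : measure_display) (T : measurableType disp) (P : probability T R)
  (o : vertex G) (X : nat -> T -> edge G)
  (X_walk : simple_random_walk P o X) :
  {ae P, forall w,
    (fun n : nat =>
       (#|` fset_set [set k : nat | (1 <= k <= n)%N /\
              nontrivial_cycle_time (fun i => X i w) k] |)%fset%:R / n%:R : R)
      @ \oo --> (0 : R)}.
Proof.
have d_gt0 : (0 < d)%N by apply: leq_trans d_ge3.
have dR : 0 < d%:R :> R by rewrite ltr0n.
have return_bound (s : R) : 2 * Num.sqrt (d%:R - 1) < s ->
    forall (y : vertex G) n,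
    walk_sum n (dirac_fun R y) y <= s ^+ n.
  move=> hs y n.
  have radius_lt : (spectral_radius R x0 < (s / d%:R)%:E)%E.
    by rewrite G_ramanujan lte_fin ltr_pM2r ?invr_gt0.
  have := walk_sum_return_le G_regular d_ge3 G_connected y n radius_lt.
  by rewrite mulrCA divff ?gt_eqF// mulr1.
pose D := dist R G_regular G_connected o.
have D_parent y : (0 < D y)%N -> exists2 e, tail e = y & (D (head e) < D y)%N.
  exact: dist_parent.
have radius1 := ramanujan_radius_lt1 R d_ge3.
pose rho : R := (2 * Num.sqrt (d%:R - 1) / d%:R + 1) / 2.
have radius0 : 0 <= 2 * Num.sqrt (d%:R - 1) / d%:R :> R.
  by rewrite divr_ge0// mulr_ge0// sqrtr_ge0.
have [rho0 [rho1 rho_gt]] : 0 < rho /\ rho < 1 /\ 2 * Num.sqrt (d%:R - 1) / d%:R < rho.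
  by move: radius0 radius1; rewrite /rho; move: (_ / d%:R) => c c0 c1; lra.
have cycle_bound (y : vertex G) n : walk_sum n (dirac_fun R y) y <= (d%:R * rho) ^+ n.
  by apply: return_bound; rewrite [_ * rho]mulrC -ltr_pdivrMr.
have no_final : {ae P, forall w, exists N, forall n, (N <= n)%N ->
    ~~ final_long_cycle (prefix X n w)}.
  have [C [b [C0 b01 Cb]]] := final_long_cycle_rare G_regular d_ge3 rho0 rho1 cycle_bound o.
  exact: (prefix_eventually G_regular d_gt0 X_walk (Q := fun=> @final_long_cycle G) C0 b01 Cb).
suff density (m : nat) : {ae P, forall w, exists N, forall n, (N <= n)%N ->
    (m * #|` fset_set [set k : nat | (1 <= k <= n)%N /\
              nontrivial_cycle_time (fun i => X i w) k] |%fset <= n)%N}.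
  have := ae_foralln density; apply: filterS => w dens.
  exact: cvg0_of_density.
have [->|m0] := posnP m; first by apply: aeW => w; exists 0%N.
have m4 : (0 < 4 * m)%N by rewrite muln_gt0.
have [L [C [b [C0 b01 Cb]]]] := long_coverage_rare G_regular d_ge3 rho0 rho1 cycle_bound o m4.
have ae_long := prefix_eventually G_regular d_gt0 X_walk
  (Q := fun n s => (n <= 4 * m * coverage (@long_cycle G L) s)%N) C0 b01 Cb.
have mL0 : (0 < 8 * L.+1 * m)%N by rewrite !muln_gt0.
have [C' [b' [C'0 b'01 Cb']]] :=
  irregular_rare G_regular d_ge3 G_connected (fun s hs => return_bound s hs o) mL0.
have ae_irr := prefix_eventually G_regular d_gt0 X_walk
  (Q := fun n s => (n <= 8 * L.+1 * m * irregular_count D s)%N) C'0 b'01 Cb'.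
apply: filterS3 no_final ae_long ae_irr => w [N1 H1] [N2 H2] [N3 H3].
exists (maxn (maxn L N1) (maxn N2 N3)) => n.
rewrite !geq_max => /andP[/andP[Ln N1n] /andP[N2n N3n]].
have two k : (k <= n)%N -> (k <= 2 * n)%N by move: (k); lia.
have := cycle_time_count D_parent Ln N1n H1.
have := H2 _ (two _ N2n); have := H3 _ (two _ N3n).
rewrite -!ltnNge -/D /prefix.
move: (irregular_count _ _) (coverage _ _) #|` _ |%fset => I cov c.
clear; nia.
Qed.
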